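(* Let $K$ be a compact Hausdorff space. Then $(\mathrm{C}(K)^\delta)^\ast$ is isometrically lattice isomorphic to $\mathrm{M}(\Sigma^{\mathcal{C}}_K,\mathcal{N}_K)$. In particular, identifying $\mathrm{C}(K)^\delta$ with $\mathrm{L}^\infty(\Sigma^{\mathcal{C}}_K,\mathcal{N}_K)$, for every $\varphi\in(\mathrm{C}(K)^\delta)^\ast$ there exists a unique $\mu_\varphi\in\mathrm{M}(\Sigma^{\mathcal{C}}_K,\mathcal{N}_K)$ such that $$\varphi(\hat u)=\int_K u\,d\mu_\varphi,\qquad \hat u\in\mathrm{C}(K)^\delta,$$ and the mapping $S:(\mathrm{C}(K)^\delta)^\ast\ni\varphi\mapsto\mu_\varphi\in\mathrm{M}(\Sigma^{\mathcal{C}}_K,\mathcal{N}_K)$ is a linear lattice isometry onto $\mathrm{M}(\Sigma^{\mathcal{C}}_K,\mathcal{N}_K)$.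
   Context: $\mathrm{C}(K)$ is the Banach lattice of continuous real-valued functions on $K$ (pointwise order, supremum norm). $\mathrm{C}(K)^\delta$ is its Dedekind completion: the unique (up to linear lattice isometry) Dedekind complete Banach lattice containing $\mathrm{C}(K)$ as a majorizing, order dense (isometrically embedded) sublattice. (A sublattice $F$ of $E$ is order dense if for every $0<f\in E$ there is $g\in F$ with $0<g\le f$, and majorizing if every $0\le f\in E$ satisfies $f\le g$ for some $g\in F$.) $\mathcal{N}_K$ is the collection of meagre subsets of $K$, and $\Sigma^{\mathcal{C}}_K=\{U\Delta N: U\subseteq K\text{ open},\ N\in\mathcal{N}_K\}$ is the $\sigma$-algebra of sets with the property of Baire. $\mathrm{B}(\Sigma^{\mathcal{C}}_K)$ is the vector lattice of bounded real-valued $\Sigma^{\mathcal{C}}_K$-measurable functions on $K$, $\mathrm{N}(\Sigma^{\mathcal{C}}_K,\mathcal{N}_K)$ is its ideal of functions vanishing off a meagre set, and $\mathrm{L}^\infty(\Sigma^{\mathcal{C}}_K,\mathcal{N}_K)=\mathrm{B}(\Sigma^{\mathcal{C}}_K)/\mathrm{N}(\Sigma^{\mathcal{C}}_K,\mathcal{N}_K)$ is the quotient vector lattice; the class of $u$ is denoted $\hat u$. Its norm is $\|\hat f\|_\infty=\inf\{c\ge 0:\{x\in K:|f(x)|>c\}\in\mathcal{N}_K\}$. The space $\mathrm{C}(K)^\delta$ is identified with $\mathrm{L}^\infty(\Sigma^{\mathcal{C}}_K,\mathcal{N}_K)$ via the embedding $\mathrm{C}(K)\ni u\mapsto\hat u$.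 $\mathrm{M}(\Sigma^{\mathcal{C}}_K,\mathcal{N}_K)$ is the Banach lattice of bounded, finitely additive, real-valued signed measures $\mu$ on $\Sigma^{\mathcal{C}}_K$ with $\mu(N)=0$ for every $N\in\mathcal{N}_K$, ordered setwise and with total variation norm $\|\mu\|=|\mu|(K)$. Integrals of bounded measurable functions with respect to such finitely additive measures are the usual ones (defined on simple functions and extended by uniform limits). *)

(* Defs.v *)
From HB Require Import structures.
From mathcomp Require Import all_boot all_order all_algebra.
From mathcomp Require Import all_classical all_reals all_analysis.

Import Order.TTheory GRing.Theory Num.Theory numFieldNormedType.Exports.

Set Implicit Arguments.
Unset Strict Implicit.
Unset Printing Implicit Defensive.

Local Open Scope classical_set_scope.
Local Open Scope ring_scope.
Local Open Scope quotient_scope.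

(* With Sigma = baire_property K and N the ideal of meagre sets:
     cfun K R            C(K)
     bmfun K R           B(Sigma)
     null_pred K R       N(Sigma, N)
     Linf K R, hat u     L^oo(Sigma, N), the class of u : bmfun K R
     bfa K R             M(Sigma, N)
     bfa_integral mu u   integral of u over K with respect to mu
     dual E              the norm dual of E, ordered by the dual cone
   x ⊑ y, x ⊔ y and x ⊓ y are the order, join and meet of vector lattices. *)

HB.mixin Record isCompactHausdorff K & Topological K := {
  compact_setT : compact [set: K];
  hausdorff_setT : hausdorff_space K
}.

#[short(type="compactHausdorffType")]
HB.structure Definition CompactHausdorff :=
  { K of Topological K & isCompactHausdorff K }.

(* The order is a fresh relation rather than that of porderType: HB has no
   join of the porderType hierarchy with the normed modules other than the
   numeric rings. *)
HB.mixin Record isVectorLattice (R : numDomainType) E & GRing.Lmodule R E := {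
  vle : E -> E -> Prop;
  vjoin : E -> E -> E;
  vle_refl : forall x, vle x x;
  vle_anti : forall x y, vle x y -> vle y x -> x = y;
  vle_trans : forall y x z, vle x y -> vle y z -> vle x z;
  vleD2r : forall z x y, vle x y -> vle (x + z) (y + z);
  vscaler_ge0 : forall (a : R) x, 0 <= a -> vle 0 x -> vle 0 (a *: x);
  vjoin_vle : forall x y z, vle (vjoin x y) z <-> vle x z /\ vle y z
}.

#[short(type="vectorLatticeType")]
HB.structure Definition VectorLattice (R : numDomainType) :=
  { E of GRing.Lmodule R E & isVectorLattice R E }.

#[short(type="normedVectorLatticeType")]
HB.structure Definition NormedVectorLattice (R : numFieldType) :=
  { E of NormedModule R E & VectorLattice R E }.

Notation "x ⊑ y" := (vle x y) (at level 70, no associativity) : ring_scope.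
Notation "x ⊔ y" := (vjoin x y) (at level 50, left associativity) : ring_scope.

HB.mixin Record hasLatticeNorm (R : numFieldType) E
    & NormedVectorLattice R E := {
  lattice_norm : forall x y : E,
    (x ⊔ (- x)) ⊑ (y ⊔ (- y)) -> `|x| <= `|y|
}.

#[short(type="banachLatticeType")]
HB.structure Definition BanachLattice (R : numFieldType) :=
  { E of NormedVectorLattice R E & Complete E & hasLatticeNorm R E }.

Arguments vle_refl {R s} x.
Arguments vle_trans {R s} [y x z].
Arguments vleD2r {R s} z [x y].

Section VectorLatticeTheory.
Context {R : numFieldType} {E : vectorLatticeType R}.
Implicit Types x y z : E.

Definition vmeet x y : E := - ((- x) ⊔ (- y)).
Definition vpos x : E := x ⊔ 0.

Lemma vle_subr x y : x ⊑ y <-> 0 ⊑ y - x.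
Proof.
split=> [/(vleD2r (- x))|/(vleD2r x)]; first by rewrite subrr.
by rewrite add0r subrK.
Qed.

Lemma vsubr_ge0 x y : x ⊑ y -> 0 ⊑ y - x.
Proof. exact: (vle_subr x y).1. Qed.

Lemma vle_subl x y : 0 ⊑ y -> x - y ⊑ x.
Proof. by move=> y0; apply/vle_subr; rewrite opprB addrC subrK. Qed.

Lemma vleN x y : x ⊑ y -> - y ⊑ - x.
Proof. by move/vle_subr => h; apply/vle_subr; rewrite opprK addrC. Qed.

Lemma vleD x y z t : x ⊑ y -> z ⊑ t -> x + z ⊑ y + t.
Proof.
move=> xy zt; apply: (vle_trans (vleD2r z xy)).
by rewrite addrC [y + t]addrC; exact: vleD2r.
Qed.

Lemma vaddr_ge0 x y : 0 ⊑ x -> 0 ⊑ y -> 0 ⊑ x + y.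
Proof. by move=> x0 y0; rewrite -[0]addr0; exact: vleD. Qed.

Lemma vle_joinl x y : x ⊑ x ⊔ y.
Proof. by case: ((vjoin_vle x y (x ⊔ y)).1 (vle_refl _)). Qed.

Lemma vle_joinr x y : y ⊑ x ⊔ y.
Proof. by case: ((vjoin_vle x y (x ⊔ y)).1 (vle_refl _)). Qed.

Lemma vjoin_le x y z : x ⊑ z -> y ⊑ z -> x ⊔ y ⊑ z.
Proof. by move=> xz yz; apply/vjoin_vle. Qed.

Lemma vjoinDr z x y : (x + z) ⊔ (y + z) = (x ⊔ y) + z.
Proof.
apply: vle_anti.
  by apply: vjoin_le; apply: vleD2r; [exact: vle_joinl|exact: vle_joinr].
rewrite -[X in _ ⊑ X](subrK z); apply: vleD2r; apply: vjoin_le.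
  by rewrite -[X in X ⊑ _](addrK z); apply: vleD2r; exact: vle_joinl.
by rewrite -[X in X ⊑ _](addrK z); apply: vleD2r; exact: vle_joinr.
Qed.

Lemma vpos_ge0 x : 0 ⊑ vpos x. Proof. exact: vle_joinr. Qed.

Lemma vposE x : x = vpos x - vpos (- x).
Proof.
suff -> : vpos (- x) = vpos x - x by rewrite subKr.
rewrite /vpos -vjoinDr subrr add0r.
by apply: vle_anti; apply: vjoin_le;
  [exact: vle_joinr|exact: vle_joinl|exact: vle_joinr|exact: vle_joinl].
Qed.

Lemma vle_meetl x y : vmeet x y ⊑ x.
Proof. by rewrite -[X in _ ⊑ X]opprK; apply: vleN; exact: vle_joinl. Qed.

Lemma vle_meetr x y : vmeet x y ⊑ y.
Proof. by rewrite -[X in _ ⊑ X]opprK; apply: vleN; exact: vle_joinr. Qed.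

Lemma vmeet_ge x y z : z ⊑ x -> z ⊑ y -> z ⊑ vmeet x y.
Proof.
by move=> zx zy; rewrite -[z]opprK; apply: vleN; apply: vjoin_le; exact: vleN.
Qed.

Lemma vriesz_decomp x y z : 0 ⊑ x -> 0 ⊑ y -> 0 ⊑ z -> z ⊑ x + y ->
  exists z1 z2, [/\ 0 ⊑ z1, z1 ⊑ x, 0 ⊑ z2, z2 ⊑ y & z = z1 + z2].
Proof.
move=> x0 y0 z0 zxy; exists (vmeet z x), (z - vmeet z x); split.
- exact: vmeet_ge.
- exact: vle_meetr.
- by apply/vle_subr; rewrite subr0; apply: (vle_subr _ _).1; exact: vle_meetl.
- rewrite /vmeet opprK addrC -vjoinDr addNr; apply: vjoin_le => //.
  by move/(vleD2r (- x)): zxy; rewrite [x + y]addrC addrK addrC.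
- by rewrite addrC subrK.
Qed.

Lemma vle0_join x : 0 ⊑ x -> x ⊔ (- x) = x.
Proof.
move=> x0; apply: vle_anti; last exact: vle_joinl.
apply: vjoin_le; first exact: vle_refl.
by apply: (@vle_trans _ _ 0) => //; rewrite -[X in _ ⊑ X]oppr0; exact: vleN.
Qed.

Lemma vmodulus_ge0 x : 0 ⊑ x ⊔ (- x).
Proof.
have h : 0 ⊑ (x ⊔ (- x)) + (x ⊔ (- x)).
  by rewrite -(subrr x); apply: vleD; [exact: vle_joinl|exact: vle_joinr].
have : 0 ⊑ 2^-1 *: ((x ⊔ (- x)) + (x ⊔ (- x))).
  by apply: vscaler_ge0 => //; rewrite invr_ge0.
by rewrite -mulr2n -[X in _ ⊑ _ *: X]scaler_nat scalerA mulVf ?pnatr_eq0// scale1r.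
Qed.

Lemma cone_extension (p : E -> R) :
  (forall x y, 0 ⊑ x -> 0 ⊑ y -> p (x + y) = p x + p y) ->
  (forall a x, 0 <= a -> 0 ⊑ x -> p (a *: x) = a * p x) ->
  (forall u v, 0 ⊑ u -> 0 ⊑ v ->
     p (vpos (u - v)) - p (vpos (- (u - v))) = p u - p v).
Proof.
move=> pD pZ u v u0 v0; have := vposE (u - v) => /eqP.
rewrite subr_eq addrAC eq_sym subr_eq => /eqP /(congr1 p).
rewrite pD ?pD//; [|exact: vpos_ge0..].
by move=> e; apply/eqP; rewrite subr_eq addrAC eq_sym subr_eq eq_sym e addrC.
Qed.

End VectorLatticeTheory.

Notation "x ⊓ y" := (vmeet x y) (at level 48, left associativity) : ring_scope.

Section BanachLatticeTheory.
Context {R : realType} {E : banachLatticeType R}.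

Lemma vnorm_le (x y : E) : 0 ⊑ x -> x ⊑ y -> `|x| <= `|y|.
Proof.
move=> x0 xy; apply: lattice_norm.
by rewrite !vle0_join//; exact: vle_trans xy.
Qed.

Lemma vnorm_pos (x : E) : `|vpos x| <= `|x|.
Proof.
apply: lattice_norm; rewrite vle0_join; last exact: vpos_ge0.
by apply: vjoin_le; [exact: vle_joinl|exact: vmodulus_ge0].
Qed.

End BanachLatticeTheory.

Section Dual.
Context {R : realType} (E : normedModType R).

Definition dual_pred : {pred E -> R} :=
  mem [set f : E -> R | scalar f /\ continuous f].

Record dual := Dual { dual_fun :> E -> R; _ : dual_fun \in dual_pred }.

HB.instance Definition _ := [isSub for dual_fun].
HB.instance Definition _ := [Choice of dual by <:].

Lemma dual_predP (f : E -> R) : reflect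
  (scalar f /\ exists2 M, 0 <= M & forall x, `|f x| <= M * `|x|)
  (f \in dual_pred).
Proof.
apply: (iffP idP) => [/set_mem[lf cf]|[lf [M M0 Mf]]].
  split=> //.
  pose f' := GRing.isLinear.Build R E R _ f lf.
  pose F : {linear E -> R} := HB.pack f f'.
  have /linear_boundedP/pinfty_ex_gt0[M M0 hM] :
    bounded_near F (nbhs (0 : E)) by exact/linear_bounded_continuous.
  by exists M => //; exact: ltW.
apply: mem_set; split=> //.
pose f' := GRing.isLinear.Build R E R _ f lf.
pose F : {linear E -> R} := HB.pack f f'.
apply: (@bounded_linear_continuous _ _ _ F); apply/bounded_funP => r.
exists (M * r) => x xr; apply: (le_trans (Mf x)).
exact: ler_wpM2l.
Qed.

Lemma dual_scalar (f : dual) : scalar f.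
Proof. by have /dual_predP[] := valP f. Qed.

Lemma dual_bound (f : dual) : exists2 M, 0 <= M & forall x, `|f x| <= M * `|x|.
Proof. by have /dual_predP[] := valP f. Qed.

Lemma dualD (f : dual) x y : f (x + y) = f x + f y.
Proof. by have := dual_scalar f 1 x y; rewrite scale1r mul1r. Qed.

Lemma dual0 (f : dual) : f 0 = 0.
Proof. by apply: (addrI (f 0)); rewrite -dualD !addr0. Qed.

Lemma dualZ (f : dual) a x : f (a *: x) = a * f x.
Proof. by have := dual_scalar f a x 0; rewrite !addr0 dual0 addr0. Qed.

Lemma dualN (f : dual) x : f (- x) = - f x.
Proof. by rewrite -scaleN1r dualZ mulN1r. Qed.

Lemma dual_pred_submod : submod_closed dual_pred.
Proof.
split=> [|a f g /dual_predP[lf [M M0 fM]] /dual_predP[lg [N N0 gN]]].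
  apply/dual_predP; split; first by move=> a x y; rewrite mulr0 addr0.
  by exists 0 => // x; rewrite normr0 mul0r.
apply/dual_predP; split=> [b x y|].
  rewrite /= !fctE lf lg /GRing.scale/= mulrDr addrACA; congr (_ + _).
  by rewrite mulrDr mulrCA.
exists (`|a| * M + N); first by rewrite addr_ge0// mulr_ge0.
move=> x; rewrite /= (le_trans (ler_normD _ _))// mulrDl lerD//.
by rewrite normrM -mulrA ler_wpM2l.
Qed.

HB.instance Definition _ :=
  GRing.isSubmodClosed.Build R (E -> R) dual_pred dual_pred_submod.
HB.instance Definition _ := [SubChoice_isSubLmodule of dual by <:].

Definition dual_norm (f : dual) : R := sup [set `|f x| | x in [set x | `|x| <= 1]].

Lemma dual_norm_has_sup (f : dual) :
  has_sup [set `|f x| | x in [set x | `|x| <= 1]].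
Proof.
split; first by exists `|f 0|, 0 => //=; rewrite normr0.
have [M M0 fM] := dual_bound f.
by exists M => _ [x /= x1 <-]; rewrite (le_trans (fM x))// ler_piMr.
Qed.

Lemma dual_norm_le (f : dual) x : `|x| <= 1 -> `|f x| <= dual_norm f.
Proof.
move=> x1; apply: ub_le_sup; first by case: (dual_norm_has_sup f).
by exists x.
Qed.

Lemma dual_norm_ge (f : dual) M :
  (forall x, `|x| <= 1 -> `|f x| <= M) -> dual_norm f <= M.
Proof.
move=> fM; apply: ge_sup; first by case: (dual_norm_has_sup f).
by move=> _ [x x1 <-]; exact: fM.
Qed.

Lemma dual_ler_normD f g : dual_norm (f + g) <= dual_norm f + dual_norm g.
Proof.
by apply: dual_norm_ge => x x1; rewrite /= (le_trans (ler_normD _ _))// lerD//;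
  exact: dual_norm_le.
Qed.

Lemma dual_norm_ge0 f : 0 <= dual_norm f.
Proof. by rewrite (le_trans _ (@dual_norm_le f 0 _)) ?normr0. Qed.

Lemma dual_normrZ_le a f : dual_norm (a *: f) <= `|a| * dual_norm f.
Proof.
apply: dual_norm_ge => x x1; rewrite /= normrM ler_wpM2l//.
exact: dual_norm_le.
Qed.

Lemma dual_normrZ a f : dual_norm (a *: f) = `|a| * dual_norm f.
Proof.
apply/eqP; rewrite eq_le dual_normrZ_le/=.
have [->|a0] := eqVneq a 0; first by rewrite normr0 mul0r dual_norm_ge0.
have := dual_normrZ_le a^-1 (a *: f).
by rewrite scalerA mulVf// scale1r normfV ler_pdivlMl ?normr_gt0.
Qed.

Lemma dual_normr0_eq0 f : dual_norm f = 0 -> f = 0.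
Proof.
move=> f0; apply/val_inj/funext => x /=.
have [->|x0] := eqVneq x 0; first by rewrite dual0.
have := @dual_norm_le f (`|x|^-1 *: x).
rewrite normrZ normfV normr_id mulVf ?normr_eq0// f0 dualZ => /(_ (lexx _)).
by rewrite normr_le0 mulf_eq0 invr_eq0 normr_eq0 (negbTE x0) => /eqP.
Qed.

HB.instance Definition _ := @Lmodule_isNormed.Build R dual dual_norm
  dual_ler_normD dual_normrZ dual_normr0_eq0.

End Dual.

Section DualLattice.
Context {R : realType} (E : banachLatticeType R).
Implicit Types f g h : dual E.

Definition dual_le f g := forall x : E, 0 ⊑ x -> f x <= g x.

Lemma dual_le_refl f : dual_le f f. Proof. by move=> x x0. Qed.

Lemma dual_le_anti f g : dual_le f g -> dual_le g f -> f = g.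
Proof.
move=> fg gf; have e x : 0 ⊑ x -> f x = g x.
  by move=> x0; apply/eqP; rewrite eq_le fg// gf.
apply/val_inj/funext => x /=.
by rewrite (vposE x) !dualD !dualN !e//; exact: vpos_ge0.
Qed.

Lemma dual_le_trans g f h : dual_le f g -> dual_le g h -> dual_le f h.
Proof. by move=> fg gh x x0; exact: le_trans (fg x x0) (gh x x0). Qed.

Lemma dual_leD2r h f g : dual_le f g -> dual_le (f + h) (g + h).
Proof. by move=> fg x x0; rewrite /= lerD2r fg. Qed.

Lemma dual_scale_ge0 (a : R) f : 0 <= a -> dual_le 0 f -> dual_le 0 (a *: f).
Proof. by move=> a0 f0 x x0; rewrite /= mulr_ge0// f0. Qed.

(* Riesz-Kantorovich formula *)
Definition rk_set f g (x : E) : set R :=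
  [set f y + g (x - y) | y in [set y : E | 0 ⊑ y /\ y ⊑ x]].
Definition rk f g (x : E) : R := sup (rk_set f g x).

Lemma rk_set_bound f g : exists2 M, 0 <= M &
  forall x : E, 0 ⊑ x -> forall r, rk_set f g x r -> `|r| <= M * `|x|.
Proof.
have [M M0 fM] := dual_bound f; have [N N0 gN] := dual_bound g.
exists (M + N); first exact: addr_ge0.
move=> x x0 _ [y [y0 yx] <-]; rewrite (le_trans (ler_normD _ _))// mulrDl.
rewrite lerD// (le_trans (fM _), le_trans (gN _))// ler_wpM2l//.
  exact: vnorm_le.
by apply: vnorm_le; [exact: vsubr_ge0|exact: vle_subl].
Qed.

Lemma rk_has_sup f g (x : E) : 0 ⊑ x -> has_sup (rk_set f g x).
Proof.
move=> x0; split; first by exists (f 0 + g (x - 0)), 0 => //=; split=> //; exact: vle_refl.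
have [M M0 h] := rk_set_bound f g.
by exists (M * `|x|) => r /(h x x0); exact/le_trans/ler_norm.
Qed.

Lemma rk_ub f g (x y : E) : 0 ⊑ y -> y ⊑ x -> f y + g (x - y) <= rk f g x.
Proof.
move=> y0 yx; apply: ub_le_sup.
  by case: (rk_has_sup f g (vle_trans y0 yx)).
by exists y.
Qed.

Lemma rk_ge f g (x : E) M : 0 ⊑ x ->
  (forall y : E, 0 ⊑ y -> y ⊑ x -> f y + g (x - y) <= M) -> rk f g x <= M.
Proof.
move=> x0 h; apply: ge_sup; first by case: (rk_has_sup f g x0).
by move=> _ [y [y0 yx] <-]; exact: h.
Qed.

Lemma rk_bound f g : exists2 M, 0 <= M &
  forall x : E, 0 ⊑ x -> `|rk f g x| <= M * `|x|.
Proof.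
have [M M0 h] := rk_set_bound f g; exists M => // x x0.
rewrite ler_norml; apply/andP; split.
  have -> : - (M * `|x|) <= rk f g x.
    apply: (@le_trans _ _ (f 0 + g (x - 0))).
      rewrite lerNl (le_trans (ler_norm _))// normrN h//.
      by exists 0 => //; split=> //; exact: vle_refl.
    by apply: rk_ub => //; exact: vle_refl.
  by [].
apply: rk_ge => // y y0 yx; rewrite (le_trans (ler_norm _))// h//.
by exists y.
Qed.

Lemma rkD f g (x y : E) : 0 ⊑ x -> 0 ⊑ y -> rk f g (x + y) = rk f g x + rk f g y.
Proof.
move=> x0 y0; have xy0 := vaddr_ge0 x0 y0; apply/eqP; rewrite eq_le; apply/andP; split.
  apply: rk_ge => // z z0 /(vriesz_decomp x0 y0 z0)[z1 [z2 [z10 z1x z20 z2y ->]]].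
  rewrite opprD (addrACA x) (dualD f z1) (dualD g (x - z1)) addrACA.
  by apply: lerD; exact: rk_ub.
rewrite -lerBrDr; apply: rk_ge => // z z0 zx.
rewrite lerBrDr -lerBrDl; apply: rk_ge => // t t0 ty.
rewrite lerBrDl addrACA -!dualD addrACA -opprD.
by apply: rk_ub; [exact: vaddr_ge0|exact: vleD].
Qed.

Lemma rkZ f g a (x : E) : 0 <= a -> 0 ⊑ x -> rk f g (a *: x) = a * rk f g x.
Proof.
have le b (y : E) : 0 < b -> 0 ⊑ y -> b * rk f g y <= rk f g (b *: y).
  move=> b0 y0; rewrite -ler_pdivlMl//; apply: rk_ge => // z z0 zy.
  rewrite ler_pdivlMl// mulrDr -!dualZ scalerBr; apply: rk_ub.
    by apply: vscaler_ge0 => //; exact: ltW.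
  by apply/vle_subr; rewrite -scalerBr; apply: vscaler_ge0; [exact: ltW|exact: vsubr_ge0].
rewrite le_eqVlt => /predU1P[<- x0|a0 x0].
  rewrite scale0r mul0r; apply: (addrI (rk f g 0)).
  by rewrite -rkD ?addr0//; exact: vle_refl.
apply/eqP; rewrite eq_le le// andbT -ler_pdivrMl//.
have := le a^-1 (a *: x); rewrite invr_gt0 scalerA mulVf ?gt_eqF// scale1r.
by apply => //; apply: vscaler_ge0 => //; exact: ltW.
Qed.

Definition dual_join_fun f g (x : E) : R := rk f g (vpos x) - rk f g (vpos (- x)).

Lemma dual_join_funB f g (u v : E) : 0 ⊑ u -> 0 ⊑ v ->
  dual_join_fun f g (u - v) = rk f g u - rk f g v.
Proof. exact: (cone_extension (@rkD f g) (@rkZ f g)). Qed.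

Lemma dual_join_fun_ge0 f g (x : E) : 0 ⊑ x -> dual_join_fun f g x = rk f g x.
Proof.
move=> x0; rewrite -[X in dual_join_fun _ _ X]subr0 dual_join_funB//; last exact: vle_refl.
suff -> : rk f g 0 = 0 by rewrite subr0.
by rewrite -[0 in LHS](scale0r x) rkZ// mul0r.
Qed.

Lemma dual_join_fun_dual f g : dual_join_fun f g \in @dual_pred R E.
Proof.
have hD : forall x y, dual_join_fun f g (x + y) = dual_join_fun f g x + dual_join_fun f g y.
  move=> x y; have [px py] := (vpos_ge0 x, vpos_ge0 y).
  have [nx ny] := (vpos_ge0 (- x), vpos_ge0 (- y)).
  rewrite {1}(vposE x) {1}(vposE y) addrACA -opprD dual_join_funB; [|exact: vaddr_ge0..].
  by rewrite !rkD// opprD addrACA.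
have hN x : dual_join_fun f g (- x) = - dual_join_fun f g x.
  by rewrite /dual_join_fun opprK opprB.
have hZ a x : 0 <= a -> dual_join_fun f g (a *: x) = a * dual_join_fun f g x.
  move=> a0; rewrite {1}(vposE x) scalerBr dual_join_funB; last 2 first.
  - by apply: vscaler_ge0 => //; exact: vpos_ge0.
  - by apply: vscaler_ge0 => //; exact: vpos_ge0.
  by rewrite !rkZ -?mulrBr//; exact: vpos_ge0.
apply/dual_predP; split=> [a x y|].
  rewrite hD; congr (_ + _); have [a0|a0] := leP 0 a; first exact: hZ.
  by rewrite -[a in LHS]opprK scaleNr hN hZ ?mulNr ?opprK// oppr_ge0 ltW.
have [M M0 h] := rk_bound f g; exists (M + M); first exact: addr_ge0.
move=> x; rewrite (le_trans (ler_normB _ _))// mulrDl lerD//.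
  by rewrite (le_trans (h _ (vpos_ge0 _)))// ler_wpM2l// vnorm_pos.
by rewrite (le_trans (h _ (vpos_ge0 _)))// ler_wpM2l// -[leRHS]normrN vnorm_pos.
Qed.

Definition dual_join f g : dual E := Dual (dual_join_fun_dual f g).

Lemma dual_joinP f g h :
  dual_le (dual_join f g) h <-> dual_le f h /\ dual_le g h.
Proof.
split=> [le|[fh gh] x x0].
  split=> x x0; apply: le_trans (le x x0); rewrite /= dual_join_fun_ge0//.
    have := @rk_ub f g x x x0 (vle_refl _).
    by rewrite subrr dual0 addr0.
  have := @rk_ub f g x 0 (vle_refl _) x0.
  by rewrite subr0 dual0 add0r.
rewrite /= dual_join_fun_ge0//; apply: rk_ge => // y y0 yx.
rewrite (_ : h x = h y + h (x - y)); last by rewrite -dualD addrC subrK.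
by rewrite lerD ?fh ?gh//; exact: vsubr_ge0.
Qed.

HB.instance Definition _ := isVectorLattice.Build R (dual E)
  dual_le_refl dual_le_anti dual_le_trans dual_leD2r dual_scale_ge0 dual_joinP.

End DualLattice.

Section Meagre.
Context {K : topologicalType}.
Implicit Types (A B U N : set K).

Definition nowhere_dense A := (closure A)° = set0.

Definition meagre A :=
  exists2 F : nat -> set K, (forall n, nowhere_dense (F n)) & A = \bigcup_n F n.

Definition comeagre : set_system K := [set A | meagre (~` A)].

Definition baire_property A :=
  exists U N, [/\ open U, meagre N & A = U `+` N].

Lemma nowhere_dense_sub A B : A `<=` B -> nowhere_dense B -> nowhere_dense A.
Proof.
move=> AB B0; apply/seteqP; split=> // x.
by rewrite -B0; apply: interiorS; exact: closureS.
Qed.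

Lemma meagre_sub A B : A `<=` B -> meagre B -> meagre A.
Proof.
move=> AB [F Fn BF]; exists (fun n => F n `&` A).
  by move=> n; apply: nowhere_dense_sub (Fn n); exact: subIsetl.
by rewrite -setI_bigcupl -BF setIC; apply/esym/setIidPl.
Qed.

Lemma meagre_bigcup (I : countType) (F : I -> set K) :
  (forall i, meagre (F i)) -> meagre (\bigcup_i F i).
Proof.
move=> mF; have /choice[G hG] i : exists G : nat -> set K,
    (forall n, nowhere_dense (G n)) /\ F i = \bigcup_n G n.
  by have [G Gn FG] := mF i; exists G.
have nd0 : nowhere_dense set0 by rewrite /nowhere_dense closure0 interior0.
exists (fun n => if @unpickle (I * nat)%type n is Some (i, m) then G i m else set0).
  by move=> n; case: unpickle => [[i m]|//]; exact: (hG i).1.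
apply/seteqP; split=> [x [i _]|x [n _]].
  rewrite (hG i).2 => -[m _ Gx]; exists (pickle (i, m)) => //=.
  by rewrite pickleK.
case: unpickle => [[i m] Gx|//]; exists i => //.
by rewrite (hG i).2; exists m.
Qed.

Lemma meagre0 : meagre (set0 : set K).
Proof.
exists (fun=> set0); last by rewrite bigcup0.
by move=> _; rewrite /nowhere_dense closure0 interior0.
Qed.

Lemma nowhere_dense_meagre A : nowhere_dense A -> meagre A.
Proof.
by move=> A0; exists (fun=> A) => //; rewrite bigcup_const//; exists 0%N.
Qed.

Lemma meagreU A B : meagre A -> meagre B -> meagre (A `|` B).
Proof.
move=> mA mB; apply: (@meagre_sub _ (\bigcup_(b : bool) if b then A else B)).
  by move=> x [Ax|Bx]; [exists true|exists false].
by apply: meagre_bigcup => -[].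
Qed.

Global Instance comeagre_filter : Filter comeagre.
Proof.
split; rewrite /comeagre /=.
- by rewrite setCT; exact: meagre0.
- by move=> A B /= mA mB; rewrite setCI; exact: meagreU.
- by move=> A B AB /=; apply: meagre_sub; exact/subsetC.
Qed.

Lemma baire_propertyP A : baire_property A <->
  exists2 U, open U & meagre (A `+` U).
Proof.
split=> [[U [N [oU mN ->]]]|[U oU mU]]; exists U => //.
  by rewrite setYC setYA setYK set0Y.
by exists (A `+` U); split; rewrite // [A `+` U]setYC setYA setYK set0Y.
Qed.

Lemma baire_open A : open A -> baire_property A.
Proof.
by move=> oA; apply/baire_propertyP; exists A => //; rewrite setYK; exact: meagre0.
Qed.

Lemma baire_meagre A : meagre A -> baire_property A.
Proof.
move=> mA; apply/baire_propertyP; exists set0; first exact: open0.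
by rewrite setY0.
Qed.

Lemma baireC A : baire_property A -> baire_property (~` A).
Proof.
move=> /baire_propertyP[U oU mU]; apply/baire_propertyP.
exists (~` closure U); first by rewrite openC; exact: closed_closure.
have nU : meagre (closure U `\` U).
  apply: nowhere_dense_meagre; rewrite /nowhere_dense.
  rewrite (_ : closure _ = closure U `\` U); last first.
    apply/esym/closure_id; apply: closedI; first exact: closed_closure.
    by rewrite closedC.
  apply/seteqP; split=> // x; rewrite setDE interiorI interiorC => -[/interior_subset].
  by [].
apply: meagre_sub (meagreU mU nU) => x /= [[nA /contrapT cU]|[cU /contrapT Ax]].
  by have [Ux|nUx] := pselect (U x); [left; right|right].
by left; left; split=> // /subset_closure.
Qed.

Lemma baire_bigcup (I : countType) (F : I -> set K) :
  (forall i, baire_property (F i)) -> baire_property (\bigcup_i F i).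
Proof.
move=> bF; have /choice[U hU] i : exists U, open U /\ meagre (F i `+` U).
  by have /baire_propertyP[U oU mU] := bF i; exists U.
apply/baire_propertyP; exists (\bigcup_i U i).
  by apply: bigcup_open => i _; exact: (hU i).1.
apply: meagre_sub (meagre_bigcup (fun i => (hU i).2)).
move=> x [[[i _ Fx] nU]|[[i _ Ux] nF]]; exists i => //.
  by left; split=> // Ux; apply: nU; exists i.
by right; split=> // Fx; apply: nF; exists i.
Qed.

Lemma baireU A B : baire_property A -> baire_property B -> baire_property (A `|` B).
Proof.
move=> bA bB; rewrite (_ : _ `|` _ = \bigcup_(b : bool) if b then A else B).
  by apply: baire_bigcup => -[].
by apply/seteqP; split=> x; [move=> [?|?]; [exists true|exists false]|move=> [[] _ ?]; [left|right]].
Qed.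

Lemma baireI A B : baire_property A -> baire_property B -> baire_property (A `&` B).
Proof.
move=> bA bB; rewrite -[A `&` B]setCK setCI.
by apply: baireC; apply: baireU; exact: baireC.
Qed.

Lemma baireD A B : baire_property A -> baire_property B -> baire_property (A `\` B).
Proof. by move=> bA bB; rewrite setDE; apply: baireI => //; exact: baireC. Qed.

Lemma baire0 : baire_property (set0 : set K).
Proof. exact/baire_open/open0. Qed.

Lemma baireT : baire_property [set: K].
Proof. exact/baire_open/openT. Qed.

Lemma baire_sigma_algebra : sigma_algebra setT baire_property.
Proof.
split; first exact: baire0.
  by move=> A bA; rewrite setTD; exact: baireC.
by move=> F bF; exact: baire_bigcup.
Qed.

End Meagre.
Arguments baire_property K : clear implicits.

Section BaireFunctions.
Context {R : realType} {K : topologicalType}.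
Implicit Types f g : K -> R.

Definition baire_measurable f :=
  forall B : set R, measurable B -> baire_property K (f @^-1` B).

Lemma baire_measurableP f :
  (forall c, baire_property K [set x | c < f x]) -> baire_measurable f.
Proof.
move=> bf B mB.
have : (measurable_realfun.RGenOInfty.G (R := R)).-sigma.-measurable B.
  by rewrite -measurable_realfun.RGenOInfty.measurableE.
move: B {mB}.
apply: (@smallest_sub _ _ _ [set B | baire_property K (f @^-1` B)]).
  split => [|A bA|F bF].
  - by rewrite /= preimage_set0; exact: baire0.
  - by rewrite /= setTD preimage_setC; exact: baireC.
  - by rewrite /= preimage_bigcup; exact: baire_bigcup.
move=> _ [c ->] /=; rewrite (_ : _ @^-1` _ = [set x | c < f x]); first exact: bf.
by apply/seteqP; split=> x /=; rewrite in_itv/= andbT.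
Qed.

Lemma baire_measurable_gt f c : baire_measurable f -> baire_property K [set x | c < f x].
Proof.
move=> /(_ [set` `]c, +oo[] (measurable_itv _)); congr baire_property.
by apply/seteqP; split=> x /=; rewrite in_itv/= andbT.
Qed.

Lemma baire_measurableD f g :
  baire_measurable f -> baire_measurable g -> baire_measurable (fun x => f x + g x).
Proof.
move=> bf bg; apply: baire_measurableP => c.
rewrite (_ : [set _ | _] = \bigcup_(q : rat)
    ([set x | ratr q < f x] `&` [set x | c - ratr q < g x])).
  by apply: baire_bigcup => q; apply: baireI; exact: baire_measurable_gt.
apply/seteqP; split=> [x /=|x [q _] [/= h1 h2]]; last first.
  by rewrite -(subrK (ratr q) c) [ltRHS]addrC; exact: ltrD.
rewrite -ltrBlDr => /rat_in_itvoo[q]; rewrite in_itv/= => /andP[q1 q2].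
by exists q => //; split=> //=; rewrite ltrBlDr addrC -ltrBlDr.
Qed.

Lemma baire_measurable_comp (h : R -> R) f :
  measurable_fun setT h -> baire_measurable f -> baire_measurable (h \o f).
Proof. by move=> mh bf B /(mh measurableT); rewrite setTI => /bf. Qed.

Lemma baire_measurable_max f g :
  baire_measurable f -> baire_measurable g ->
  baire_measurable (fun x => Num.max (f x) (g x)).
Proof.
move=> bf bg; apply: baire_measurableP => c.
rewrite (_ : [set _ | _] = [set x | c < f x] `|` [set x | c < g x]).
  by apply: baireU; exact: baire_measurable_gt.
by apply/seteqP; split=> x /=; rewrite lt_max => /orP.
Qed.

Lemma continuous_baire_measurable f : continuous f -> baire_measurable f.
Proof.
move=> cf; apply: baire_measurableP => c; apply: baire_open.
rewrite (_ : [set _ | _] = f @^-1` [set y | c < y]); last by [].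
by apply: open_comp; [by move=> x _; exact: cf|exact: open_gt].
Qed.

Definition bmfun_pred : {pred K -> R} :=
  mem [set f | baire_measurable f /\ exists M : R, forall x, `|f x| <= M].

Lemma bmfun_submod : submod_closed bmfun_pred.
Proof.
split=> [|a f g /set_mem[bf [M fM]] /set_mem[bg [N gN]]]; apply: mem_set; split.
- by apply: continuous_baire_measurable; exact: cst_continuous.
- by exists 0 => x; rewrite normr0.
- apply: baire_measurableD => //.
  exact: (baire_measurable_comp (measurable_realfun.mulrl_measurable a)).
- exists (`|a| * M + N) => x; rewrite /= (le_trans (ler_normD _ _))// lerD//.
  by rewrite normrM ler_wpM2l.
Qed.

End BaireFunctions.

Section BoundedBaire.
Variables (K : topologicalType) (R : realType).

Record bmfun := BMFun { bmfun_fun :> K -> R; _ : bmfun_fun \in bmfun_pred }.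

HB.instance Definition _ := [isSub for bmfun_fun].
HB.instance Definition _ := [Choice of bmfun by <:].
HB.instance Definition _ :=
  GRing.isSubmodClosed.Build R (K -> R) bmfun_pred bmfun_submod.
HB.instance Definition _ := [SubChoice_isSubLmodule of bmfun by <:].

Lemma bmfunD (f g : bmfun) x : (f + g : bmfun) x = f x + g x. Proof. by []. Qed.
Lemma bmfunN (f : bmfun) x : (- f : bmfun) x = - f x. Proof. by []. Qed.
Lemma bmfunB (f g : bmfun) x : (f - g : bmfun) x = f x - g x. Proof. by []. Qed.
Lemma bmfunZ a (f : bmfun) x : (a *: f : bmfun) x = a * f x. Proof. by []. Qed.
Lemma bmfun0 x : (0 : bmfun) x = 0. Proof. by []. Qed.

Lemma bmfun_measurable (f : bmfun) : baire_measurable f.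
Proof. by have /set_mem[] := valP f. Qed.

Lemma bmfun_bounded (f : bmfun) : exists M : R, forall x, `|f x| <= M.
Proof. by have /set_mem[] := valP f. Qed.

Definition null_pred : {pred bmfun} :=
  mem [set f : bmfun | comeagre [set x | f x = 0]].

Lemma null_zmod : zmod_closed null_pred.
Proof.
split=> [|f g /set_mem hf /set_mem hg]; apply: mem_set.
  exact: filterE.
apply: filterS2 hf hg => x fx gx.
by rewrite /mkset bmfunB fx gx subrr.
Qed.

HB.instance Definition _ := GRing.isZmodClosed.Build bmfun null_pred null_zmod.

Definition Linf := {ideal_quot null_pred}.
HB.instance Definition _ := GRing.Zmodule.on Linf.
HB.instance Definition _ := EqQuotient.on Linf.

Definition hat (f : bmfun) : Linf := \pi_Linf f.

Lemma hatP (f g : bmfun) : hat f = hat g <-> comeagre [set x | f x = g x].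
Proof.
split=> [/eqP|h].
  rewrite /hat -Quotient.idealrBE => /set_mem; apply: filterS => x.
  by rewrite /mkset bmfunB => /eqP; rewrite subr_eq0 => /eqP.
apply/eqP; rewrite -Quotient.idealrBE; apply/mem_set.
by apply: filterS h => x fx; rewrite /mkset bmfunB fx subrr.
Qed.

Lemma repr_hat (f : bmfun) : comeagre [set x | repr (hat f) x = f x].
Proof. by apply/hatP; rewrite /hat reprK. Qed.

Lemma hat_repr (q : Linf) : hat (repr q) = q.
Proof. by rewrite /hat reprK. Qed.

Lemma hatD (f g : bmfun) : hat (f + g) = hat f + hat g.
Proof. by rewrite /hat !piE. Qed.

Lemma hat0 : hat 0 = 0.
Proof. by apply: (addrI (hat 0)); rewrite -hatD !addr0. Qed.

Lemma hat_lift (P : Linf -> Prop) : (forall f, P (hat f)) -> forall q, P q.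
Proof. by move=> h q; rewrite -[q]hat_repr. Qed.

Definition Linf_scale (a : R) (q : Linf) : Linf := hat (a *: repr q).

Lemma hat_scale a (f : bmfun) : Linf_scale a (hat f) = hat (a *: f).
Proof. by apply/hatP; apply: filterS (repr_hat f) => x; rewrite /mkset !bmfunZ => ->. Qed.

Lemma Linf_scaleA a b (q : Linf) :
  Linf_scale a (Linf_scale b q) = Linf_scale (a * b) q.
Proof. by elim/hat_lift: q => f; rewrite !hat_scale scalerA. Qed.

Lemma Linf_scale1 : left_id 1 Linf_scale.
Proof. by elim/hat_lift => f; rewrite hat_scale scale1r. Qed.

Lemma Linf_scaleDr : right_distributive Linf_scale +%R.
Proof.
move=> a p q; elim/hat_lift: p => f; elim/hat_lift: q => g.
by rewrite -hatD !hat_scale -hatD scalerDr.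
Qed.

Lemma Linf_scaleDl q : {morph Linf_scale^~ q : a b / a + b}.
Proof.
by elim/hat_lift: q => f a b /=; rewrite !hat_scale -hatD scalerDl.
Qed.

HB.instance Definition _ := GRing.Zmodule_isLmodule.Build R Linf
  Linf_scaleA Linf_scale1 Linf_scaleDr Linf_scaleDl.

Lemma hatZ a (f : bmfun) : hat (a *: f) = a *: hat f.
Proof. by rewrite -hat_scale. Qed.

Definition Linf_norm (q : Linf) : R :=
  inf [set c | 0 <= c /\ meagre [set x | c < `|repr q x|]].

Lemma meagre_gt (f : K -> R) c :
  meagre [set x | c < f x] <-> comeagre [set x | f x <= c].
Proof.
rewrite /comeagre /= (_ : ~` _ = [set x | c < f x])//.
by apply/seteqP; split=> x /=; rewrite ltNge => /negP.
Qed.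

Lemma Linf_norm_has_inf (q : Linf) :
  has_inf [set c | 0 <= c /\ meagre [set x | c < `|repr q x|]].
Proof.
split; last by exists 0 => c [].
have [M hM] := bmfun_bounded (repr q).
exists (Num.max 0 M); split; first by rewrite le_max lexx.
apply/meagre_gt; apply: filterE => x /=.
by rewrite (le_trans (hM x))// le_max lexx orbT.
Qed.

Lemma Linf_norm_ge0 q : 0 <= Linf_norm q.
Proof. by apply: lb_le_inf; [case: (Linf_norm_has_inf q)|move=> c []]. Qed.

Lemma Linf_norm_le (f : bmfun) c : 0 <= c ->
  comeagre [set x | `|f x| <= c] -> Linf_norm (hat f) <= c.
Proof.
move=> c0 h; apply: ge_inf; first by case: (Linf_norm_has_inf (hat f)).
split=> //; apply/meagre_gt.
by apply: filterS2 (repr_hat f) h => x /= ->.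
Qed.

Lemma Linf_normP (f : bmfun) : comeagre [set x | `|f x| <= Linf_norm (hat f)].
Proof.
apply/meagre_gt.
apply: (@meagre_sub _ _ (\bigcup_n [set x | Linf_norm (hat f) + n.+1%:R^-1 < `|f x|])).
  by move=> x /= /ltr_add_invr[n hn]; exists n.
apply: meagre_bigcup => n; apply/meagre_gt.
have n0 : 0 < n.+1%:R^-1 :> R by rewrite invr_gt0.
have [c [c0 /meagre_gt hc] cn] := inf_adherent n0 (Linf_norm_has_inf (hat f)).
apply: filterS2 (repr_hat f) hc => x /= -> /le_trans; apply; exact: ltW.
Qed.

Lemma Linf_ler_normD p q : Linf_norm (p + q) <= Linf_norm p + Linf_norm q.
Proof.
elim/hat_lift: p => f; elim/hat_lift: q => g; rewrite -hatD.
apply: Linf_norm_le; first by rewrite addr_ge0 ?Linf_norm_ge0.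
apply: filterS2 (Linf_normP f) (Linf_normP g) => x fx gx.
by rewrite /mkset bmfunD; apply: le_trans (ler_normD _ _) _; apply: lerD.
Qed.

Lemma Linf_normrZ_le a q : Linf_norm (a *: q) <= `|a| * Linf_norm q.
Proof.
elim/hat_lift: q => f; rewrite -hatZ.
apply: Linf_norm_le; first by rewrite mulr_ge0 ?Linf_norm_ge0.
by apply: filterS (Linf_normP f) => x fx; rewrite /mkset bmfunZ normrM ler_wpM2l.
Qed.

Lemma Linf_normrZ a q : Linf_norm (a *: q) = `|a| * Linf_norm q.
Proof.
apply/eqP; rewrite eq_le Linf_normrZ_le/=.
have [->|a0] := eqVneq a 0; first by rewrite normr0 mul0r Linf_norm_ge0.
have := Linf_normrZ_le a^-1 (a *: q).
by rewrite scalerA mulVf// scale1r normfV ler_pdivlMl ?normr_gt0.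
Qed.

Lemma Linf_normr0_eq0 q : Linf_norm q = 0 -> q = 0.
Proof.
elim/hat_lift: q => f f0; rewrite -hat0; apply/hatP.
apply: filterS (Linf_normP f) => x /=.
by rewrite f0 normr_le0 => /eqP.
Qed.

HB.instance Definition _ := @Lmodule_isNormed.Build R Linf Linf_norm
  Linf_ler_normD Linf_normrZ Linf_normr0_eq0.

Definition Linf_le (p q : Linf) := comeagre [set x | repr p x <= repr q x].

Lemma Linf_leP (f g : bmfun) :
  Linf_le (hat f) (hat g) <-> comeagre [set x | f x <= g x].
Proof.
by split; apply: filterS3 (repr_hat f) (repr_hat g) => x /= -> ->.
Qed.

Lemma bmfun_max_pred (f g : bmfun) :
  (fun x => Num.max (f x) (g x)) \in @bmfun_pred R K.
Proof.
have [M fM] := bmfun_bounded f; have [N gN] := bmfun_bounded g.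
apply/mem_set; split.
  by apply: baire_measurable_max; exact: bmfun_measurable.
exists (Num.max M N) => x; rewrite le_max.
by have [_|_] := leP (f x) (g x); rewrite ?fM ?gN ?orbT.
Qed.

Definition bmfun_max (f g : bmfun) : bmfun := BMFun (bmfun_max_pred f g).

Definition Linf_join (p q : Linf) : Linf := hat (bmfun_max (repr p) (repr q)).

Lemma Linf_le_refl p : Linf_le p p.
Proof. by apply: filterE => x /=. Qed.

Lemma Linf_le_anti p q : Linf_le p q -> Linf_le q p -> p = q.
Proof.
move=> pq qp; rewrite -[p]hat_repr -[q]hat_repr; apply/hatP.
by apply: filterS2 pq qp => x /= h1 h2; apply/eqP; rewrite eq_le h1.
Qed.

Lemma Linf_le_trans q p r : Linf_le p q -> Linf_le q r -> Linf_le p r.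
Proof. by apply: filterS2 => x /=; exact: le_trans. Qed.

Lemma Linf_leD2r r p q : Linf_le p q -> Linf_le (p + r) (q + r).
Proof.
elim/hat_lift: p => f; elim/hat_lift: q => g; elim/hat_lift: r => h.
rewrite -!hatD => /Linf_leP fg; apply/Linf_leP.
by apply: filterS fg => x fg; rewrite /mkset !bmfunD lerD2r.
Qed.

Lemma Linf_scale_ge0 (a : R) p : 0 <= a -> Linf_le 0 p -> Linf_le 0 (a *: p).
Proof.
elim/hat_lift: p => f; rewrite -hat0 -hatZ.
move=> a0 /Linf_leP f0; apply/Linf_leP.
by apply: filterS f0 => x f0; rewrite /mkset bmfunZ mulr_ge0.
Qed.

Lemma Linf_joinP p q r :
  Linf_le (Linf_join p q) r <-> Linf_le p r /\ Linf_le q r.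
Proof.
elim/hat_lift: r => h; rewrite /Linf_join Linf_leP.
split=> [le|[pr qr]].
  split; rewrite -[X in Linf_le X]hat_repr; apply/Linf_leP.
    by apply: filterS le => x /=; rewrite ge_max => /andP[].
  by apply: filterS le => x /=; rewrite ge_max => /andP[].
apply: filterS3 pr qr (repr_hat h) => x /= px qx <-.
by rewrite ge_max px.
Qed.

HB.instance Definition _ := isVectorLattice.Build R Linf
  Linf_le_refl Linf_le_anti Linf_le_trans Linf_leD2r Linf_scale_ge0 Linf_joinP.

End BoundedBaire.

Section ContinuousFunctions.
Variables (K : compactHausdorffType) (R : realType).

Definition cfun_pred : {pred K -> R} := mem [set f : K -> R | continuous f].

Record cfun := CFun { cfun_fun :> K -> R; _ : cfun_fun \in cfun_pred }.

HB.instance Definition _ := [isSub for cfun_fun].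
HB.instance Definition _ := [Choice of cfun by <:].

Lemma cfun_submod : submod_closed cfun_pred.
Proof.
split=> [|a f g /set_mem cf /set_mem cg]; apply: mem_set.
  exact: cst_continuous.
by move=> x; apply: cvgD; [apply: cvgZr; exact: cf|exact: cg].
Qed.

HB.instance Definition _ :=
  GRing.isSubmodClosed.Build R (K -> R) cfun_pred cfun_submod.
HB.instance Definition _ := [SubChoice_isSubLmodule of cfun by <:].

Lemma cfunD (f g : cfun) x : (f + g : cfun) x = f x + g x. Proof. by []. Qed.
Lemma cfunZ a (f : cfun) x : (a *: f : cfun) x = a * f x. Proof. by []. Qed.
Lemma cfun0 x : (0 : cfun) x = 0. Proof. by []. Qed.

Lemma cfun_continuous (f : cfun) : continuous f.
Proof. exact: (set_mem (valP f)). Qed.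

Lemma cfun_bounded (f : cfun) : exists M : R, forall x, `|f x| <= M.
Proof.
have : compact (f @` [set: K]).
  apply: continuous_compact; last exact: compact_setT.
  exact/continuous_subspaceT/cfun_continuous.
move=> /compact_bounded/pinfty_ex_gt0[M M0 hM]; exists M => x.
by apply: hM; exists x.
Qed.

Definition cfun_norm (f : cfun) : R := sup [set `|f x| | x in [set: K]].

Lemma cfun_norm_ge (f : cfun) x : `|f x| <= cfun_norm f.
Proof.
apply: ub_le_sup; last by exists x.
by have [M fM] := cfun_bounded f; exists M => _ [y _ <-].
Qed.

Lemma cfun_norm_le (f : cfun) M : 0 <= M ->
  (forall x, `|f x| <= M) -> cfun_norm f <= M.
Proof.
move=> M0 fM; rewrite /cfun_norm.
have [->|/set0P ne] := eqVneq [set `|f x| | x in [set: K]] set0; first by rewrite sup0.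
by apply: ge_sup => // _ [x _ <-].
Qed.

Lemma cfun_norm_ge0 f : 0 <= cfun_norm f.
Proof.
have [e|/set0P[x _]] := eqVneq [set: K] set0.
  by rewrite /cfun_norm e image_set0 sup0.
exact: le_trans (cfun_norm_ge f x).
Qed.

Lemma cfun_ler_normD f g : cfun_norm (f + g) <= cfun_norm f + cfun_norm g.
Proof.
apply: cfun_norm_le => [|x]; first by rewrite addr_ge0 ?cfun_norm_ge0.
by rewrite cfunD (le_trans (ler_normD _ _))// lerD// cfun_norm_ge.
Qed.

Lemma cfun_normrZ_le a f : cfun_norm (a *: f) <= `|a| * cfun_norm f.
Proof.
apply: cfun_norm_le => [|x]; first by rewrite mulr_ge0 ?cfun_norm_ge0.
by rewrite cfunZ normrM ler_wpM2l// cfun_norm_ge.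
Qed.

Lemma cfun_normrZ a f : cfun_norm (a *: f) = `|a| * cfun_norm f.
Proof.
apply/eqP; rewrite eq_le cfun_normrZ_le/=.
have [->|a0] := eqVneq a 0; first by rewrite normr0 mul0r cfun_norm_ge0.
have := cfun_normrZ_le a^-1 (a *: f).
by rewrite scalerA mulVf// scale1r normfV ler_pdivlMl ?normr_gt0.
Qed.

Lemma cfun_normr0_eq0 f : cfun_norm f = 0 -> f = 0.
Proof.
move=> f0; apply/val_inj/funext => x /=.
by have := cfun_norm_ge f x; rewrite f0 normr_le0 => /eqP.
Qed.

HB.instance Definition _ := @Lmodule_isNormed.Build R cfun cfun_norm
  cfun_ler_normD cfun_normrZ cfun_normr0_eq0.

Definition cfun_le (f g : cfun) := forall x, f x <= g x.

Lemma cfun_max_pred (f g : cfun) :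
  (fun x => Num.max (f x) (g x)) \in cfun_pred.
Proof.
apply/mem_set => x.
by apply: continuous_max; exact: cfun_continuous.
Qed.

Definition cfun_max (f g : cfun) : cfun := CFun (cfun_max_pred f g).

Lemma cfun_le_refl f : cfun_le f f. Proof. by move=> x. Qed.

Lemma cfun_le_anti f g : cfun_le f g -> cfun_le g f -> f = g.
Proof.
by move=> fg gf; apply/val_inj/funext => x; apply/eqP; rewrite eq_le fg gf.
Qed.

Lemma cfun_le_trans g f h : cfun_le f g -> cfun_le g h -> cfun_le f h.
Proof. by move=> fg gh x; exact: le_trans (fg x) (gh x). Qed.

Lemma cfun_leD2r h f g : cfun_le f g -> cfun_le (f + h) (g + h).
Proof. by move=> fg x; rewrite !cfunD lerD2r. Qed.

Lemma cfun_scale_ge0 (a : R) f : 0 <= a -> cfun_le 0 f -> cfun_le 0 (a *: f).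
Proof. by move=> a0 f0 x; rewrite cfunZ mulr_ge0//; exact: f0. Qed.

Lemma cfun_maxP f g h :
  cfun_le (cfun_max f g) h <-> cfun_le f h /\ cfun_le g h.
Proof.
split=> [le|[fh gh] x]; last by rewrite /= ge_max fh gh.
by split=> x; have := le x; rewrite /= ge_max => /andP[].
Qed.

HB.instance Definition _ := isVectorLattice.Build R cfun
  cfun_le_refl cfun_le_anti cfun_le_trans cfun_leD2r cfun_scale_ge0 cfun_maxP.

Lemma cfun_bmfun_pred (f : cfun) : (f : K -> R) \in @bmfun_pred R K.
Proof.
apply/mem_set; split; last exact: cfun_bounded.
exact/continuous_baire_measurable/cfun_continuous.
Qed.

Definition bmfun_of_cfun (f : cfun) : bmfun K R := BMFun (cfun_bmfun_pred f).

End ContinuousFunctions.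

Section FinitelyAdditiveMeasures.
Variables (K : topologicalType) (R : realType).
Implicit Types A B N : set K.
Local Notation baire := (baire_property K).

(* A measure on Sigma is encoded as a function on all subsets of K that is 0
   outside Sigma, so that equality of measures is equality of functions. *)
Definition bfa_pred : {pred set K -> R} := mem [set mu : set K -> R |
  [/\ forall A, ~ baire A -> mu A = 0,
      forall A B, baire A -> baire B -> A `&` B = set0 ->
        mu (A `|` B) = mu A + mu B,
      exists M : R, forall A, `|mu A| <= M &
      forall N, meagre N -> mu N = 0]].

Record bfa := Bfa { bfa_fun :> set K -> R; _ : bfa_fun \in bfa_pred }.

HB.instance Definition _ := [isSub for bfa_fun].
HB.instance Definition _ := [Choice of bfa by <:].

Lemma bfa_submod : submod_closed bfa_pred.
Proof.
split=> [|a f g /set_mem[f1 f2 [M f3] f4] /set_mem[g1 g2 [M' g3] g4]]; apply: mem_set.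
  by split=> //; [move=> *; rewrite addr0|exists 0 => A; rewrite normr0].
split=> [A nA|A B bA bB AB||N mN].
- by rewrite /= !fctE f1// g1// scaler0 addr0.
- by rewrite /= !fctE f2// g2// scalerDr addrACA.
- exists (`|a| * M + M') => A; rewrite /= (le_trans (ler_normD _ _))// lerD//.
  by rewrite normrM ler_wpM2l.
- by rewrite /= !fctE f4// g4// scaler0 addr0.
Qed.

HB.instance Definition _ :=
  GRing.isSubmodClosed.Build R (set K -> R) bfa_pred bfa_submod.
HB.instance Definition _ := [SubChoice_isSubLmodule of bfa by <:].

Implicit Types mu nu xi : bfa.

Lemma bfaDE mu nu A : (mu + nu : bfa) A = mu A + nu A. Proof. by []. Qed.
Lemma bfaZE a mu A : (a *: mu : bfa) A = a * mu A. Proof. by []. Qed.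
Lemma bfa0E A : (0 : bfa) A = 0. Proof. by []. Qed.

Lemma bfa_out mu A : ~ baire A -> mu A = 0.
Proof. by have /set_mem[+ _ _ _] := valP mu; exact. Qed.

Lemma bfaU mu A B : baire A -> baire B -> A `&` B = set0 ->
  mu (A `|` B) = mu A + mu B.
Proof. by have /set_mem[_ + _ _] := valP mu; exact. Qed.

Lemma bfa_bound mu : exists M : R, forall A, `|mu A| <= M.
Proof. by have /set_mem[] := valP mu. Qed.

Lemma bfa_meagre mu N : meagre N -> mu N = 0.
Proof. by have /set_mem[_ _ _] := valP mu; exact. Qed.

Lemma bfa_set0 mu : mu set0 = 0.
Proof. exact/bfa_meagre/meagre0. Qed.

Definition bfa_variation_set (mu : set K -> R) A : set R :=
  [set r | exists n (F : 'I_n -> set K),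
    [/\ forall i, baire (F i) /\ F i `<=` A, trivIset setT F &
        r = \sum_(i < n) `|mu (F i)|]].

Definition bfa_variation (mu : set K -> R) A : R := sup (bfa_variation_set mu A).

Lemma bfa_bigsetU mu n (F : 'I_n -> set K) (P : pred 'I_n) :
  (forall i, baire (F i)) -> trivIset setT F ->
  baire (\big[setU/set0]_(i < n | P i) F i) /\
  mu (\big[setU/set0]_(i < n | P i) F i) = \sum_(i < n | P i) mu (F i).
Proof.
move=> bF tF; have : uniq (index_enum 'I_n) by exact: index_enum_uniq.
elim: (index_enum _) => [|j s IH] /=.
  by rewrite !big_nil bfa_set0; split=> //; exact: baire0.
move=> /andP[js /IH[b e]]; rewrite !big_cons; case: ifPn => // Pj.
split; first exact: baireU.
rewrite bfaU ?e//.
apply/seteqP; split=> // x [Fjx]; rewrite -bigcup_seq_cond => -[i /= /andP[si _] Fix].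
have ij : i = j by apply: tF => //; exists x.
by move: js; rewrite -ij si.
Qed.

Lemma bfa_variation_has_sup mu A : has_sup (bfa_variation_set mu A).
Proof.
split.
  exists 0, 0%N, (fun=> set0); split=> [[]//|[]//|].
  by rewrite big_ord0.
have [M hM] := bfa_bound mu; exists (M + M) => _ [n [F [bF tF ->]]].
rewrite (bigID (fun i => 0 <= mu (F i)))/=.
have bF' i : baire (F i) by case: (bF i).
apply: lerD.
  rewrite (eq_bigr (fun i => mu (F i))); last by move=> i /ger0_norm.
  rewrite -(bfa_bigsetU mu _ bF' tF).2; exact: le_trans (ler_norm _) (hM _).
rewrite (eq_bigr (fun i => - mu (F i))); last first.
  by move=> i; rewrite -ltNge => /ltr0_norm.
rewrite sumrN -(bfa_bigsetU mu _ bF' tF).2 (le_trans (ler_norm _))// normrN.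
exact: hM.
Qed.

Definition bfa_norm mu : R := bfa_variation mu setT.

Lemma bfa_norm_ub mu n (F : 'I_n -> set K) :
  (forall i, baire (F i)) -> trivIset setT F ->
  \sum_(i < n) `|mu (F i)| <= bfa_norm mu.
Proof.
move=> bF tF; apply: ub_le_sup; first by case: (bfa_variation_has_sup mu setT).
by exists n, F; split=> // i; split.
Qed.

Lemma bfa_norm_le mu M :
  (forall n (F : 'I_n -> set K), (forall i, baire (F i)) -> trivIset setT F ->
    \sum_(i < n) `|mu (F i)| <= M) -> bfa_norm mu <= M.
Proof.
move=> h; apply: ge_sup; first by case: (bfa_variation_has_sup mu setT).
by move=> _ [n [F [bF tF ->]]]; apply: h => // i; case: (bF i).
Qed.

Lemma bfa_norm_ge mu A : `|mu A| <= bfa_norm mu.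
Proof.
have [bA|nA] := pselect (baire A).
  have := @bfa_norm_ub mu 1 (fun=> A) (fun=> bA).
  rewrite big_ord1; apply => i j _ _ _.
  by rewrite (ord1 i) (ord1 j).
rewrite bfa_out// normr0.
have := @bfa_norm_ub mu 0 (fun=> A); rewrite big_ord0; apply.
  by case.
by case.
Qed.

Lemma bfa_norm_ge0 mu : 0 <= bfa_norm mu.
Proof. exact: le_trans (bfa_norm_ge mu set0). Qed.

Lemma bfa_ler_normD mu nu : bfa_norm (mu + nu) <= bfa_norm mu + bfa_norm nu.
Proof.
apply: bfa_norm_le => n F bF tF.
apply: (@le_trans _ _ (\sum_(i < n) (`|mu (F i)| + `|nu (F i)|))).
  by apply: ler_sum => i _; rewrite bfaDE ler_normD.
by rewrite big_split/= lerD// bfa_norm_ub.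
Qed.

Lemma bfa_normrZ_le a mu : bfa_norm (a *: mu) <= `|a| * bfa_norm mu.
Proof.
apply: bfa_norm_le => n F bF tF.
rewrite (eq_bigr (fun i => `|a| * `|mu (F i)|)); last first.
  by move=> i _; rewrite bfaZE normrM.
by rewrite -mulr_sumr ler_wpM2l// bfa_norm_ub.
Qed.

Lemma bfa_normrZ a mu : bfa_norm (a *: mu) = `|a| * bfa_norm mu.
Proof.
apply/eqP; rewrite eq_le bfa_normrZ_le/=.
have [->|a0] := eqVneq a 0; first by rewrite normr0 mul0r bfa_norm_ge0.
have := bfa_normrZ_le a^-1 (a *: mu).
by rewrite scalerA mulVf// scale1r normfV ler_pdivlMl ?normr_gt0.
Qed.

Lemma bfa_normr0_eq0 mu : bfa_norm mu = 0 -> mu = 0.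
Proof.
move=> mu0; apply/val_inj/funext => A /=.
by have := bfa_norm_ge mu A; rewrite mu0 normr_le0 => /eqP.
Qed.

HB.instance Definition _ := @Lmodule_isNormed.Build R bfa bfa_norm
  bfa_ler_normD bfa_normrZ bfa_normr0_eq0.

Definition bfa_le mu nu := forall A, baire A -> mu A <= nu A.

Definition bfa_join_set mu nu A : set R :=
  [set mu B + nu (A `\` B) | B in [set B | baire B /\ B `<=` A]].

Definition bfa_join_fun mu nu A : R :=
  if `[< baire A >] then sup (bfa_join_set mu nu A) else 0.

Lemma bfa_join_bound mu nu : exists M : R, forall A r,
  bfa_join_set mu nu A r -> `|r| <= M.
Proof.
have [M hM] := bfa_bound mu; have [N hN] := bfa_bound nu.
by exists (M + N) => A _ [B _ <-]; rewrite (le_trans (ler_normD _ _))// lerD.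
Qed.

Lemma bfa_join_has_sup mu nu A : has_sup (bfa_join_set mu nu A).
Proof.
split.
  by exists (mu set0 + nu (A `\` set0)), set0 => //; split=> //; exact: baire0.
have [M hM] := bfa_join_bound mu nu.
by exists M => r /hM; exact/le_trans/ler_norm.
Qed.

Lemma bfa_join_ub mu nu A B : baire A -> baire B -> B `<=` A ->
  mu B + nu (A `\` B) <= bfa_join_fun mu nu A.
Proof.
move=> bA bB BA; rewrite /bfa_join_fun asboolT//.
apply: ub_le_sup; first by case: (bfa_join_has_sup mu nu A).
by exists B.
Qed.

Lemma bfa_join_le mu nu A M : baire A ->
  (forall B, baire B -> B `<=` A -> mu B + nu (A `\` B) <= M) ->
  bfa_join_fun mu nu A <= M.
Proof.
move=> bA h; rewrite /bfa_join_fun asboolT//.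
apply: ge_sup; first by case: (bfa_join_has_sup mu nu A).
by move=> _ [B [bB BA] <-]; exact: h.
Qed.

Lemma bfa_join_pred mu nu : bfa_join_fun mu nu \in bfa_pred.
Proof.
apply/mem_set; split=> [A nA|A1 A2 b1 b2 A12||N mN].
- by rewrite /bfa_join_fun asboolF.
- apply/eqP; rewrite eq_le; apply/andP; split.
    apply: bfa_join_le => [|B bB BA]; first exact: baireU.
    have -> : B = (B `&` A1) `|` (B `&` A2).
      by rewrite -setIUr; apply/esym/setIidPl.
    have -> : (A1 `|` A2) `\` ((B `&` A1) `|` (B `&` A2)) =
        (A1 `\` (B `&` A1)) `|` (A2 `\` (B `&` A2)).
      apply/seteqP; split=> x /=.
        by move=> [[?|?] h]; [left|right]; split=> // -[? ?]; apply: h; [left|right].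
      move=> [[A1x h]|[A2x h]]; split; [by left| |by right|].
        move=> [//|[_ A2x]].
        by have : (A1 `&` A2) x by []; rewrite A12.
      move=> [[_ A1x]|//].
      by have : (A1 `&` A2) x by []; rewrite A12.
    have bI1 : baire (B `&` A1) by exact: baireI.
    have bI2 : baire (B `&` A2) by exact: baireI.
    rewrite (bfaU mu bI1 bI2); last first.
      by apply/seteqP; split=> // x [[_ A1x] [_ A2x]]; rewrite -A12.
    rewrite bfaU; [|exact: baireD..|]; last first.
      by apply/seteqP; split=> // x [[A1x _] [A2x _]]; rewrite -A12.
    by rewrite addrACA; apply: lerD; apply: bfa_join_ub.
  rewrite -lerBrDr; apply: bfa_join_le => // B1 bB1 BA1.
  rewrite lerBrDr -lerBrDl; apply: bfa_join_le => // B2 bB2 BA2.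
  rewrite lerBrDl addrACA -bfaU//; last first.
    by apply/seteqP; split=> // x [/BA1 ? /BA2 ?]; rewrite -A12.
  rewrite -bfaU; [|exact: baireD..|]; last first.
    by apply/seteqP; split=> // x [[? _] [? _]]; rewrite -A12.
  have -> : (A1 `\` B1) `|` (A2 `\` B2) = (A1 `|` A2) `\` (B1 `|` B2).
    apply/seteqP; split=> x /=.
      move=> [[A1x h]|[A2x h]]; split; [by left| |by right|].
        by move=> [//|/BA2 A2x]; have : (A1 `&` A2) x by []; rewrite A12.
      by move=> [/BA1 A1x|//]; have : (A1 `&` A2) x by []; rewrite A12.
    by move=> [[?|?] h]; [left|right]; split=> // ?; apply: h; [left|right].
  apply: bfa_join_ub; [exact: baireU|exact: baireU|].
  exact: setUSS.
- have [M hM] := bfa_join_bound mu nu; exists `|M| => A.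
  rewrite /bfa_join_fun; case: asboolP => bA; last by rewrite normr0.
  have := ub_le_sup (proj2 (bfa_join_has_sup mu nu A)).
  have s0 : bfa_join_set mu nu A (mu set0 + nu (A `\` set0)).
    by exists set0 => //; split=> //; exact: baire0.
  move=> /(_ _ s0) h; rewrite ler_norml; apply/andP; split.
    apply: le_trans h; rewrite lerNl (le_trans (ler_norm _))// normrN.
    exact: le_trans (hM _ _ s0) (ler_norm _).
  apply: ge_sup; first by exists (mu set0 + nu (A `\` set0)).
  by move=> r /hM rM; exact: le_trans (ler_norm _) (le_trans rM (ler_norm _)).
- have h0 B : B `<=` N -> mu B + nu (N `\` B) = 0.
    move=> BN; have mB : meagre B by exact: meagre_sub mN.
    have mNB : meagre (N `\` B) by apply: meagre_sub mN; exact: subDsetl.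
    by rewrite !bfa_meagre ?addr0.
  apply/eqP; rewrite eq_le; apply/andP; split.
    by apply: bfa_join_le => [|B _ /h0->//]; exact: baire_meagre.
  by rewrite -(h0 set0)// bfa_join_ub//; [exact: baire_meagre|exact: baire0].
Qed.

Definition bfa_join mu nu : bfa := Bfa (bfa_join_pred mu nu).

Lemma bfa_le_refl mu : bfa_le mu mu. Proof. by move=> A. Qed.

Lemma bfa_le_anti mu nu : bfa_le mu nu -> bfa_le nu mu -> mu = nu.
Proof.
move=> h1 h2; apply/val_inj/funext => A /=.
have [bA|nA] := pselect (baire A); last by rewrite !bfa_out.
by apply/eqP; rewrite eq_le h1 ?h2.
Qed.

Lemma bfa_le_trans nu mu xi : bfa_le mu nu -> bfa_le nu xi -> bfa_le mu xi.
Proof. by move=> h1 h2 A bA; exact: le_trans (h1 _ bA) (h2 _ bA). Qed.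

Lemma bfa_leD2r xi mu nu : bfa_le mu nu -> bfa_le (mu + xi) (nu + xi).
Proof. by move=> h A bA; rewrite !bfaDE lerD2r h. Qed.

Lemma bfa_scale_ge0 (a : R) mu : 0 <= a -> bfa_le 0 mu -> bfa_le 0 (a *: mu).
Proof. by move=> a0 h A bA; rewrite bfaZE mulr_ge0//; exact: h. Qed.

Lemma bfa_joinP mu nu xi :
  bfa_le (bfa_join mu nu) xi <-> bfa_le mu xi /\ bfa_le nu xi.
Proof.
split=> [h|[h1 h2] A bA].
  split=> A bA; apply: le_trans (h A bA) => /=.
    have := @bfa_join_ub mu nu A A bA bA (@subset_refl _ _).
    by rewrite setDv bfa_set0 addr0.
  have := @bfa_join_ub mu nu A set0 bA baire0 (@sub0set _ _).
  by rewrite setD0 bfa_set0 add0r.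
apply: bfa_join_le => // B bB BA.
rewrite (_ : xi A = xi B + xi (A `\` B)).
  by apply: lerD; [exact: h1|apply: h2; exact: baireD].
rewrite -bfaU//; [|exact: baireD|by rewrite setDIK].
by rewrite setDUK.
Qed.

HB.instance Definition _ := isVectorLattice.Build R bfa
  bfa_le_refl bfa_le_anti bfa_le_trans bfa_leD2r bfa_scale_ge0 bfa_joinP.

End FinitelyAdditiveMeasures.

Section Integral.
Context {K : topologicalType} {R : realType}.
Implicit Types (mu : bfa K R) (u s : bmfun K R).

(* only meaningful when s has finite range, as in simple_approx *)
Definition simple_integral mu s : R :=
  \sum_(r \in range s) r * mu (s @^-1` [set r]).

Definition simple_approx u (e : R) : set (bmfun K R) :=
  [set s | finite_set (range s) /\ forall x, `|u x - s x| <= e].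

(* s tends to u uniformly, among functions of finite range *)
Definition bfa_integral mu u : R :=
  lim (simple_integral mu s @[s --> filter_from [set e | 0 < e] (simple_approx u)]).

End Integral.

Section LatticeIsometry.
Context {R : realType} {X Y : normedVectorLatticeType R}.

Record lattice_isometry (f : X -> Y) : Prop := {
  lattice_isometry_linear : linear f;
  lattice_isometry_join : {morph f : x y / x ⊔ y};
  lattice_isometry_meet : {morph f : x y / x ⊓ y};
  lattice_isometry_norm : forall x, `|f x| = `|x|
}.

Definition isometric_lattice_isomorphism (f : X -> Y) : Prop :=
  lattice_isometry f /\ forall y, exists x, f x = y.

End LatticeIsometry.

Section DedekindCompletion.
Context {R : realType}.

Definition dedekind_complete (E : vectorLatticeType R) : Prop :=
  forall A : set E, A !=set0 -> (exists b, forall x, A x -> x ⊑ b) ->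
  exists s, (forall x, A x -> x ⊑ s) /\
            (forall b, (forall x, A x -> x ⊑ b) -> s ⊑ b).

Definition order_dense (E : vectorLatticeType R) (F : set E) : Prop :=
  forall f : E, 0 ⊑ f -> f <> 0 ->
  exists g, [/\ F g, 0 ⊑ g, g <> 0 & g ⊑ f].

Definition majorizing (E : vectorLatticeType R) (F : set E) : Prop :=
  forall f : E, 0 ⊑ f -> exists2 g, F g & f ⊑ g.

Record dedekind_completion (X : normedVectorLatticeType R)
    (E : banachLatticeType R) (j : X -> E) : Prop := {
  completion_complete : dedekind_complete E;
  completion_embedding : lattice_isometry j;
  completion_majorizing : majorizing (range j);
  completion_order_dense : order_dense (range j)
}.

End DedekindCompletion.

(* T identifies E with Linf so that j becomes the embedding u |-> hat u. *)
Definition Linf_identification {R : realType} {K : compactHausdorffType}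
    {E : banachLatticeType R} (j : cfun K R -> E) (T : E -> Linf K R) : Prop :=
  isometric_lattice_isomorphism T /\
  forall u : cfun K R, T (j u) = hat (bmfun_of_cfun u).

(* Main.v *)
(* Every element of a Dedekind completion is the supremum of the elements of
   C(K) below it, so matching these lower sets identifies any two completions;
   the norm is recovered from the constants, as |x| <= c 1 iff ||x|| <= c.  The
   space L^oo is such a completion: a bounded family in C(K) has its pointwise
   supremum, a lower semicontinuous function, as supremum modulo meagre sets by
   the Baire category theorem, and C(K) is order dense by Urysohn's lemma.

   A functional phi on L^oo is the integral against mu(A) = phi(hat 1_A), both
   being bounded functionals that agree on simple functions; testing phi on
   signed simple functions gives ||mu|| <= ||phi||.  An order isomorphism is
   automatically a lattice isomorphism, so it remains to compare the cones. *)

Require Import Defs.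
From HB Require Import structures.
From mathcomp Require Import all_boot all_order all_algebra.
From mathcomp Require Import all_classical all_reals all_analysis.
From mathcomp Require Import finmap ring.

Import Order.TTheory GRing.Theory Num.Theory numFieldNormedType.Exports.

Set Implicit Arguments.
Unset Strict Implicit.
Unset Printing Implicit Defensive.

Local Open Scope classical_set_scope.
Local Open Scope ring_scope.

(** * Linear maps given as bare functions *)

Section LinearFunctions.
Context {R : pzRingType} {U V : lmodType R} {f : U -> V} (lf : linear f).

Lemma linear_fun0 : f 0 = 0.
Proof. by have := lf (-1) 0 0; rewrite scaler0 addr0 scaleN1r addNr. Qed.

Lemma linear_funD x y : f (x + y) = f x + f y.
Proof. by have := lf 1 x y; rewrite !scale1r. Qed.

Lemma linear_funZ a x : f (a *: x) = a *: f x.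
Proof. by have := lf a x 0; rewrite linear_fun0 !addr0. Qed.

Lemma linear_funN x : f (- x) = - f x.
Proof. by rewrite -scaleN1r linear_funZ scaleN1r. Qed.

Lemma linear_funB x y : f (x - y) = f x - f y.
Proof. by rewrite linear_funD linear_funN. Qed.

End LinearFunctions.

(** * Dense completions *)

Section OrderIsomorphisms.
Context {R : realType} {X Y : vectorLatticeType R} {f : X -> Y}.
Hypotheses (f_le : forall x y, f x ⊑ f y <-> x ⊑ y).
Hypotheses (f_surj : forall y, exists x, f x = y).

Lemma order_iso_inj : injective f.
Proof.
by move=> x y xy; apply: vle_anti; apply/f_le; rewrite xy; exact: vle_refl.
Qed.

Lemma order_iso_join : {morph f : x y / x ⊔ y}.
Proof.
move=> x y; apply: vle_anti; last first.
  by apply: vjoin_le; apply/f_le; [exact: vle_joinl|exact: vle_joinr].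
have [z zE] := f_surj (f x ⊔ f y); rewrite -zE; apply/f_le.
by apply: vjoin_le; apply/f_le; rewrite zE; [exact: vle_joinl|exact: vle_joinr].
Qed.

Lemma order_iso_meet : linear f -> {morph f : x y / x ⊓ y}.
Proof.
by move=> lf x y; rewrite /vmeet !(linear_funN lf) order_iso_join !(linear_funN lf).
Qed.

End OrderIsomorphisms.

(** The order is encoded by joins ([x ⊑ y] iff [x ⊔ y = y]), and an isometry is injective. *)
Lemma lattice_isometry_le (R : realType) (X Y : normedVectorLatticeType R)
    (f : X -> Y) : lattice_isometry f -> forall x y, f x ⊑ f y <-> x ⊑ y.
Proof.
move=> [lf fj _ fn] x y.
have f_inj z : f z = 0 -> z = 0.
  by move=> fz; apply/normr0_eq0; rewrite -fn fz normr0.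
have joinE (E : vectorLatticeType R) (z t : E) : z ⊑ t <-> z ⊔ t = t.
  split=> [zt|<-]; last exact: vle_joinl.
  apply: vle_anti; last exact: vle_joinr.
  by apply: vjoin_le => //; exact: vle_refl.
rewrite !joinE -fj; split=> [/eqP|->//].
by rewrite -subr_eq0 -(linear_funB lf) => /eqP/f_inj/eqP; rewrite subr_eq0 => /eqP.
Qed.

Lemma vleBr (R : realType) (E : vectorLatticeType R) (x y z : E) :
  x ⊑ y - z <-> x + z ⊑ y.
Proof.
by split=> [/(vleD2r z)|/(vleD2r (- z))]; rewrite ?subrK ?addrK.
Qed.

Section DenseCompletions.
Context {R : realType}.
Implicit Types X E : vectorLatticeType R.

Definition vlub E (A : set E) (s : E) :=
  (forall x, A x -> x ⊑ s) /\ forall b, (forall x, A x -> x ⊑ b) -> s ⊑ b.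

(** Purely order-theoretic common ground of an abstract Dedekind completion and [Linf]. Suprema are
    required only for families coming from [X], which is what can be checked directly in [Linf]. *)
Record dense_completion X E (i : X -> E) : Prop := {
  dense_completion_linear : linear i;
  dense_completion_le : forall u v, i u ⊑ i v <-> u ⊑ v;
  dense_completion_majorizing : majorizing (range i);
  dense_completion_order_dense : order_dense (range i);
  dense_completion_lub : forall A : set X, A !=set0 ->
    (exists b, forall u, A u -> i u ⊑ b) -> exists s, vlub (i @` A) s
}.

Definition lower_image X E E' (i : X -> E) (i' : X -> E') (x : E) : set E' :=
  [set i' u | u in [set u | i u ⊑ x]].

Lemma lower_neq0 X E (i : X -> E) (x : E) : dense_completion i ->
  exists u, i u ⊑ x.
Proof.
move=> [li _ mi _ _]; have [_ [v _ <-] xv] := mi _ (vmodulus_ge0 (- x)).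
exists (- v); rewrite (linear_funN li) -[X in _ ⊑ X]opprK; apply: vleN.
exact: vle_trans (vle_joinl _ _) xv.
Qed.

(* If the supremum [s] of the lower elements were not [x], a nonzero [i w]
   below [x - s] could be added to all of them. *)
Lemma vlub_lower X E (i : X -> E) (x : E) : dense_completion i ->
  vlub (lower_image i i x) x.
Proof.
move=> ic; have [li _ _ di si] := ic.
have [s [ub lub]] : exists s, vlub (lower_image i i x) s.
  by apply: si; [exact: lower_neq0|exists x].
suff xs : x = s by rewrite [X in vlub _ X]xs.
have sx : s ⊑ x by apply: lub => _ [u ux <-].
apply/eqP; rewrite -subr_eq0; apply/eqP; apply: contrapT => xs0.
have [_ [[w _ <-] w0 wN0 wxs]] := di _ (vsubr_ge0 sx) xs0.
apply: wN0; apply: vle_anti => //.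
rewrite -(subrr s); apply/vleBr; rewrite addrC; apply/vleBr.
apply: lub => _ [u ux <-]; apply/vleBr; rewrite -(linear_funD li).
have su : i u ⊑ s by apply: ub; exists u.
apply: ub; exists (u + w) => //=; rewrite (linear_funD li).
by have := vleD su wxs; rewrite [s + _]addrC subrK.
Qed.

Section Comparison.
Context {X E E' : vectorLatticeType R} {i : X -> E} {i' : X -> E'}.
Hypotheses (ic : dense_completion i) (ic' : dense_completion i').

(** An upper bound in [E'] comes from any [v] with [i v ⊑ - x]: then [i (- v)] dominates [x], so
    [i' (- v)] dominates the lower image. *)
Lemma lower_image_vlub x : exists s, vlub (lower_image i i' x) s.
Proof.
have [li le _ _ _] := ic; have [li' le' _ _ lub'] := ic'.
apply: lub'; first exact: lower_neq0.
have [v vx] := lower_neq0 (- x) ic; exists (i' (- v)) => u ux.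
apply/le'/le; apply: vle_trans ux _.
by rewrite (linear_funN li) -[X in X ⊑ _]opprK; exact: vleN.
Qed.

(** The supremum admits no new elements of [X]. If [i' u ⊑ s], then [i' u ⊑ i' (- v)] whenever
    [i v ⊑ - x], that is, [i v ⊑ - i u]; as [- x] is the supremum of these [i v], it lies below
    [- i u]. *)
Lemma lower_image_le x s u : vlub (lower_image i i' x) s ->
  i' u ⊑ s <-> i u ⊑ x.
Proof.
move=> [ub lub]; split=> [us|ux]; last by apply: ub; exists u.
have [li le _ _ _] := ic; have [li' le' _ _ _] := ic'.
rewrite -[X in X ⊑ _]opprK -[X in _ ⊑ X]opprK; apply: vleN.
have [_ ] := vlub_lower (- x) ic; apply => _ [v vx <-].
rewrite -[X in X ⊑ _]opprK -(linear_funN li); apply: vleN.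
apply/le/le'; apply: vle_trans us _; apply: lub => _ [w wx <-].
apply/le'/le; apply: vle_trans wx _; rewrite (linear_funN li).
by rewrite -[X in X ⊑ _]opprK; exact: vleN.
Qed.

Lemma dense_completion_ext (x y : E) : (forall u, i u ⊑ x -> i u ⊑ y) -> x ⊑ y.
Proof.
by move=> h; have [_] := vlub_lower x ic; apply => _ [u ux <-]; exact: h.
Qed.

End Comparison.

Section Isomorphism.
Context {X E E' : vectorLatticeType R} {i : X -> E} {i' : X -> E'}.
Hypotheses (ic : dense_completion i) (ic' : dense_completion i').

(** [T x] is the supremum in [E'] of the lower image of [x]. By [iT] it has the same lower set in
    [X] as [x], so by [eqT] identities reduce to comparing lower sets. *)
Lemma dense_completion_iso : exists T : E -> E',
  [/\ linear T, forall x y, T x ⊑ T y <-> x ⊑ y,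
      forall y, exists x, T x = y & forall u, T (i u) = i' u].
Proof.
have [li le _ _ _] := ic; have [li' le' _ _ _] := ic'.
have /choice[T TP] := lower_image_vlub ic ic'.
have iT u x : i' u ⊑ T x <-> i u ⊑ x by exact: (lower_image_le ic ic').
have eqT x y : (forall u, i' u ⊑ y <-> i u ⊑ x) -> T x = y.
  move=> h; apply: vle_anti; apply: (dense_completion_ext ic') => u.
    by move/iT/h.
  by move/h/iT.
have Tle x y : T x ⊑ T y <-> x ⊑ y.
  split=> xy; last first.
    by apply: (dense_completion_ext ic') => u /iT ux; apply/iT/(vle_trans ux).
  by apply: (dense_completion_ext ic) => u /iT ux; apply/iT/(vle_trans ux).
have Ti u : T (i u) = i' u by apply: eqT => v; rewrite le le'.
(* Negation turns lower bounds from [X] into upper bounds, which [Ti] and [Tle] also transport. *)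
have TN x : T (- x) = - T x.
  apply: eqT => u; rewrite -[u]opprK (linear_funN li') (linear_funN li).
  split=> /vleN; rewrite !opprK => h.
    by apply: vleN; apply/Tle; rewrite Ti.
  by apply: vleN; rewrite -Ti; apply/Tle.
have Tsup x y : T x + T y ⊑ T (x + y).
  have h1 v : i v ⊑ y -> T x ⊑ T (x + y) - i' v.
    move=> vy; have [_] := TP x; apply => _ [u ux <-].
    apply/vleBr; rewrite -(linear_funD li').
    by apply/iT; rewrite (linear_funD li); exact: vleD.
  rewrite addrC; apply/vleBr; have [_] := TP y; apply => _ [v /h1/vleBr vy <-].
  by apply/vleBr; rewrite addrC.
have TD x y : T (x + y) = T x + T y.
  (* The reverse inequality is superadditivity at [x + y] and [- y]. *)
  apply: vle_anti => //; have := Tsup (x + y) (- y).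
  by rewrite addrK TN -vleBr opprK.
have Tpos a x : 0 < a -> T (a *: x) = a *: T x.
  move=> a0; have aN0 : a != 0 by rewrite gt_eqF.
  have scale (F : vectorLatticeType R) (y z : F) b : 0 < b -> y ⊑ z -> b *: y ⊑ b *: z.
    move=> b0 /vle_subr yz; apply/vle_subr; rewrite -scalerBr.
    by apply: vscaler_ge0 => //; exact: ltW.
  have scaleP (F : vectorLatticeType R) (y z : F) : y ⊑ a *: z <-> a^-1 *: y ⊑ z.
    split=> [h|/(scale _ _ _ _ a0)]; last by rewrite scalerA divff// scale1r.
    rewrite -[z](scalerK aN0); apply: scale => //; by rewrite invr_gt0.
  apply: eqT => u; rewrite !scaleP -(linear_funZ li') -(linear_funZ li).
  exact: iT.
exists T; split=> //.
- move=> a x y; rewrite TD; congr (_ + _); have [a0|a0|->] := ltgtP a 0.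
  + by rewrite -[a in LHS]opprK scaleNr TN Tpos ?oppr_gt0// scaleNr opprK.
  + exact: Tpos.
  + by rewrite !scale0r -(subrr (0 : E)) TD TN subrr.
(* The preimage is built by the same construction with the two completions exchanged. *)
- move=> y; have [x xP] := lower_image_vlub ic' ic y; exists x.
  by apply: eqT => u; rewrite (lower_image_le ic' ic _ xP).
Qed.

End Isomorphism.
End DenseCompletions.

(** * The completion of C(K) modulo meagre sets *)

Section BaireCategory.
Context {K : compactHausdorffType}.
Implicit Types (A U V : set K).

(** [U] cannot lie inside [closure A], which has empty interior; regularity of [K] shrinks a
    neighbourhood of a point of [U] outside [closure A]. *)
Lemma shrink_open U A : open U -> U !=set0 -> nowhere_dense A ->
  exists V, [/\ open V, V !=set0 & closure V `<=` U `\` A].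
Proof.
move=> oU [x0 Ux0] ndA.
have oW : open (U `\` closure A).
  by rewrite setDE; apply: openI => //; rewrite openC; exact: closed_closure.
have [x Wx] : (U `\` closure A) !=set0.
  apply/set0P/eqP => W0; have : (closure A)° x0.
    rewrite /interior nbhsE /=; exists U => // y Uy; apply: contrapT => nAy.
    by have : (U `\` closure A) y by []; rewrite W0.
  by rewrite ndA.
have [W nW WU] : filter_from (nbhs x) closure (U `\` closure A).
  apply: (compact_regular (V := setT) hausdorff_setT compact_setT filterT).
  by rewrite nbhsE /=; exists (U `\` closure A).
exists W°; split; [exact: open_interior|by exists x; exact: nW|].
move=> y /(closureS (@interior_subset _ W))/WU[Uy nAy]; split=> // Ay.
exact/nAy/subset_closure.
Qed.

(* Baire category theorem: shrink [U] around a point avoiding the nowhere dense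
   sets one after the other and let compactness provide a common point. *)
Lemma open_meagre U : open U -> meagre U -> U = set0.
Proof.
move=> oU [F Fnd UF]; apply/eqP/negP => /negP/set0P U0.
have /choice[step stepP] (p : nat * set K) : exists W, open p.2 -> p.2 !=set0 ->
    [/\ open W, W !=set0 & closure W `<=` p.2 `\` F p.1].
  have [[Vo ne]|h] := pselect (open p.2 /\ p.2 !=set0).
    by have [W Wp] := shrink_open Vo ne (Fnd p.1); exists W.
  by exists set0 => Vo ne; case: h.
pose V := fix V n := if n is m.+1 then step (m, V m) else U.
have VP n : open (V n) /\ V n !=set0.
  elim: n => [//|n [Vo ne]] /=.
  by have [] := stepP (n, V n) Vo ne.
have VS n : closure (V n.+1) `<=` V n `\` F n.
  by have [Vo ne] := VP n; have [] := stepP (n, V n) Vo ne.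
have Vle n m : (n <= m)%N -> V m `<=` V n.
  elim: m => [|m IH]; first by rewrite leqn0 => /eqP->.
  rewrite leq_eqVlt => /predU1P[->//|/IH mn] x Vx; apply: mn.
  by have [] := VS m x (subset_closure Vx).
have PF : ProperFilter (filter_from [set: nat] V).
  apply: filter_from_proper; last by move=> n _; case: (VP n).
  apply: filter_from_filter; first by exists 0%N.
  move=> n m _ _; exists (maxn n m) => // x Vx.
  by split; apply: Vle Vx; rewrite ?leq_maxl ?leq_maxr.
have [|p [_ pcl]] := compact_setT _ PF; first exact: filterT.
have pV n : closure (V n) p by move=> B nB; apply: pcl => //; exists n.
have Up : U p by have [] := VS 0%N p (pV 1%N).
move: Up; rewrite UF => -[n _ Fp].
by have [] := VS n p (pV n.+1).
Qed.

Lemma comeagre_meet_open U A : open U -> U !=set0 -> comeagre A -> U `&` A !=set0.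
Proof.
move=> oU /set0P/eqP U0 cA; apply/set0P/eqP => UA0; apply: U0.
by apply: open_meagre => //; apply: meagre_sub cA; exact/disjoints_subset.
Qed.

(** [V] is the open set equal to [A] modulo a meagre set. The last clause says that generic points
    of [V] belong to [A]. *)
Lemma baire_not_meagre A : baire_property K A -> ~ meagre A ->
  exists V, [/\ open V, V !=set0 & comeagre (A `|` ~` V)].
Proof.
move=> /baire_propertyP[V oV mAV] nmA; exists V; split=> //.
  apply/set0P/eqP => V0; apply: nmA; apply: meagre_sub mAV.
  by rewrite V0 setY0.
rewrite /comeagre /= setCU setCK; apply: meagre_sub mAV => x [nAx Vx].
by right.
Qed.

End BaireCategory.

(** * The embedding of C(K) into [Linf] *)

Section ContinuousInLinf.
Context {K : compactHausdorffType} {R : realType}.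
Implicit Types (u v : cfun K R) (g : bmfun K R).

Definition cfun_hat u : Linf K R := hat (bmfun_of_cfun u).

Lemma cfun_cst_pred (c : R) : (fun=> c) \in @cfun_pred K R.
Proof. by apply/mem_set; exact: cst_continuous. Qed.

Definition cfun_cst (c : R) : cfun K R := CFun (cfun_cst_pred c).

Lemma cfun_hat_linear : linear cfun_hat.
Proof.
by move=> a u v; rewrite /cfun_hat -hatZ -hatD; congr hat; exact/val_inj.
Qed.

(** The set where [v < u] is open, so if nonempty it would meet the comeagre set. *)
Lemma comeagre_le_cfun u v : comeagre [set x | u x <= v x] -> u ⊑ v.
Proof.
move=> uv x; rewrite leNgt; apply/negP => vu.
have oU : open [set y | v y < u y].
  rewrite (_ : [set _ | _] = (fun y => u y - v y) @^-1` [set r | 0 < r]); last first.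
    by apply/seteqP; split=> y /=; rewrite subr_gt0.
  apply: open_comp; last exact: open_gt.
  by move=> y _; apply: cvgB; exact: cfun_continuous.
have [|y [/= yvu]] := comeagre_meet_open oU _ uv; first by exists x.
by rewrite leNgt yvu.
Qed.

Lemma cfun_hat_le u v : cfun_hat u ⊑ cfun_hat v <-> u ⊑ v.
Proof.
split=> [/Linf_leP|uv]; first exact: comeagre_le_cfun.
by apply/Linf_leP; apply: filterE => x; exact: uv.
Qed.

Lemma bmfun_le_cst g : exists M : R, hat g ⊑ cfun_hat (cfun_cst M).
Proof.
have [M gM] := bmfun_bounded g; exists M; apply/Linf_leP.
by apply: filterE => x; exact: le_trans (ler_norm _) (gM x).
Qed.

Lemma cfun_hat_majorizing : majorizing (range cfun_hat).
Proof.
elim/hat_lift => g _; have [M gM] := bmfun_le_cst g.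
by exists (cfun_hat (cfun_cst M)) => //; exists (cfun_cst M).
Qed.

Lemma cfun_bump (U : set K) x : open U -> U x ->
  exists u : cfun K R,
    [/\ forall y, 0 <= u y, u x = 1, forall y, u y <= 1 & forall y, ~ U y -> u y = 0].
Proof.
move=> oU Ux.
have cx : closed [set x].
  by apply: compact_closed; [exact: hausdorff_setT|exact: compact_set1].
have [| | | |f [cf f0 f1 f01]] := @urysohn_ext_itv K R
    (compact_normal hausdorff_setT compact_setT) (~` U) [set x] 0 1.
- by rewrite closedC.
- exact: cx.
- by apply/seteqP; split=> // y [nUy yx]; apply: nUy; rewrite yx.
- exact: ltr01.
have fP : f \in @cfun_pred K R by exact: mem_set.
have fI y : 0 <= f y <= 1.
  by have /= := f01 (f y) (ex_intro2 _ _ y I erefl); rewrite in_itv.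
exists (CFun fP).
split=> [y| |y|y nUy] /=; [by case/andP: (fI y)|by apply: f1; exists x| |].
  by case/andP: (fI y).
by apply: f0; exists y.
Qed.

(** A nonzero positive class exceeds some [n.+1%:R^-1] on a nonmeagre set, hence generically on a
    nonempty open [V]; a bump vanishing off [V], scaled to that height, lies below it. *)
Lemma cfun_hat_order_dense : order_dense (range cfun_hat).
Proof.
have hat0E := linear_fun0 cfun_hat_linear.
elim/hat_lift => g g0 gN0; move: g0; rewrite -hat0 => /Linf_leP g0.
have [n gn] : exists n, ~ meagre [set x | n.+1%:R^-1 < g x].
  apply: contrapT => /forallNP gn; apply: gN0; rewrite -hat0; apply/hatP.
  have mg : meagre [set x | 0 < g x].
    apply: (@meagre_sub _ _ (\bigcup_n [set x | n.+1%:R^-1 < g x])).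
      by move=> x /= /ltr_add_invr[n]; rewrite add0r => hn; exists n.
    by apply: meagre_bigcup => n; apply: contrapT; exact: gn.
  move/meagre_gt : mg; apply: filterS2 g0 => x /= g0 g0'.
  by apply/eqP; rewrite eq_le g0'.
have [V [Vo [x Vx] gV]] := baire_not_meagre (baire_measurable_gt _ (bmfun_measurable g)) gn.
have [u [u0 ux u1 uV]] := cfun_bump Vo Vx.
have c0 : 0 < n.+1%:R^-1 :> R by rewrite invr_gt0.
pose w : cfun K R := n.+1%:R^-1 *: u.
exists (cfun_hat w); split; first by exists w.
- suff : cfun_hat 0 ⊑ cfun_hat w by rewrite hat0E hat0.
  by apply/cfun_hat_le => y; rewrite cfunZ mulr_ge0//; exact: u0.
- move=> w0; have : w ⊑ 0.
    by apply/cfun_hat_le; rewrite w0 hat0E hat0; exact: vle_refl.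
  by move=> /(_ x); rewrite cfunZ ux mulr1 leNgt c0.
- apply/Linf_leP; apply: filterS2 g0 gV => y /= g0 [gy|nVy].
    apply: le_trans (ltW gy); rewrite -[leRHS]mulr1 ler_wpM2l//.
  by have /= -> : w y = 0 by rewrite cfunZ uV// mulr0.
Qed.

Section PointwiseSupremum.
Variables (A : set (cfun K R)) (M : R).
Hypotheses (A0 : A !=set0) (AM : forall u x, A u -> u x <= M).

Let fam x := [set u x | u in A].

Let fam_has_sup x : has_sup (fam x).
Proof.
by split; [have [u Au] := A0; exists (u x), u|exists M => _ [u Au <-]; exact: AM].
Qed.

Lemma cfun_sup_ge u x : A u -> u x <= sup (fam x).
Proof. by move=> Au; apply: ub_le_sup; [case: (fam_has_sup x)|exists u]. Qed.

Lemma cfun_sup_gt c x : c < sup (fam x) -> exists2 u, A u & c < u x.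
Proof.
move=> cx; have [|_ [u Au <-]] := @sup_adherent R (fam x) (sup (fam x) - c) _ (fam_has_sup x).
  by rewrite subr_gt0.
by rewrite subKr => cu; exists u.
Qed.

(** Lower semicontinuity: the strict superlevel sets are unions of open sets. A single member of [A]
    bounds the supremum from below, [M] from above. *)
Lemma cfun_sup_pred : (fun x => sup (fam x)) \in @bmfun_pred R K.
Proof.
apply/mem_set; split.
  apply: baire_measurableP => c; apply: baire_open.
  rewrite (_ : [set _ | _] = \bigcup_(u in A) [set x | c < u x]).
    apply: bigcup_open => u Au; apply: (@open_comp _ _ u [set r | c < r]).
      by move=> x _; exact: cfun_continuous.
    exact: open_gt.
  apply/seteqP; split=> [x /cfun_sup_gt[u Au cu]|x [u Au /= cu]]; first by exists u.
  by apply: lt_le_trans cu _; exact: cfun_sup_ge.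
have [u0 Au0] := A0; have [N uN] := cfun_bounded u0.
exists (Num.max N M) => x; rewrite ler_norml; apply/andP; split.
  apply: le_trans (cfun_sup_ge x Au0); rewrite lerNl.
  by rewrite (le_trans (ler_norm _))// normrN le_max uN.
apply: ge_sup; first by case: (fam_has_sup x).
by move=> _ [u Au <-]; rewrite le_max (AM x Au) orbT.
Qed.

Definition cfun_sup : bmfun K R := BMFun cfun_sup_pred.

(* If [g < q < cfun_sup] on a nonmeagre set, one member of the family exceeds
   [q] on a nonempty open set on which [g < q] generically. *)
Lemma cfun_sup_vlub : vlub (cfun_hat @` A) (hat cfun_sup).
Proof.
split=> [_ [u Au <-]|].
  by apply/Linf_leP; apply: filterE => x; exact: cfun_sup_ge.
elim/hat_lift => g Ag; apply/Linf_leP; rewrite /comeagre /=.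
pose B (q : rat) := [set x | ratr q < cfun_sup x] `\` [set x | ratr q < g x].
suff mB q : meagre (B q).
  apply: meagre_sub (meagre_bigcup mB) => x /= /negP; rewrite -ltNge => gf.
  have [q] := rat_in_itvoo gf; rewrite in_itv/= => /andP[gq qf].
  by exists q => //; split=> //=; apply/negP; rewrite -leNgt ltW.
apply: contrapT => nmB.
have bB : baire_property K (B q).
  by apply: baireD; apply: baire_measurable_gt; exact: bmfun_measurable.
have [V [Vo V0 BV]] := baire_not_meagre bB nmB.
have [x [Vx [[qf _]|//]]] := comeagre_meet_open Vo V0 BV.
have [u Au qu] := cfun_sup_gt qf.
have Wo : open (V `&` [set y | ratr q < u y]).
  apply: openI => //; apply: (@open_comp _ _ u [set r | ratr q < r]).
    by move=> y _; exact: cfun_continuous.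
  exact: open_gt.
have ug : comeagre [set y | u y <= g y].
  by apply: (Linf_leP (bmfun_of_cfun u) g).1; apply: Ag; exists u.
have [|y [[Vy /= quy] [[[_ /= ngq]|//] ugy]]] := comeagre_meet_open Wo _ (filterI BV ug).
  by exists x.
by apply: ngq; exact: lt_le_trans ugy.
Qed.

End PointwiseSupremum.

Lemma cfun_hat_dense_completion : dense_completion cfun_hat.
Proof.
split; [exact: cfun_hat_linear|exact: cfun_hat_le|exact: cfun_hat_majorizing|
  exact: cfun_hat_order_dense|] => A A0 [q]; elim/hat_lift: q => g Ag.
have [M gM] := bmfun_le_cst g.
(* Comparing with a constant rather than with [g] turns a bound modulo meagre sets into one valid at
   every point. *)
have AM u x : A u -> u x <= M.
  by move=> /Ag ug; have /cfun_hat_le := vle_trans ug gM; exact.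
by exists (hat (cfun_sup A0 AM)); exact: cfun_sup_vlub.
Qed.

Lemma Linf_norm_cst (q : Linf K R) c : 0 <= c ->
  `|q| <= c <-> q ⊔ - q ⊑ cfun_hat (cfun_cst c).
Proof.
elim/hat_lift: q => g c0; split=> [gc|].
  (* Negation is written as scaling by [-1], so that [hatZ] yields a representative. *)
  apply: vjoin_le; last rewrite -[X in X ⊑ _]scaleN1r -hatZ; apply/Linf_leP;
    apply: filterS (Linf_normP g) => x /= gx; have := le_trans gx gc;
    rewrite ler_norml => /andP[g1 g2] //.
  by rewrite -[leLHS]/(-1 * g x) mulN1r lerNl.
move=> h; have /Linf_leP g1 := vle_trans (vle_joinl _ _) h.
have := vle_trans (vle_joinr _ _) h.
rewrite -[X in X ⊑ _]scaleN1r -hatZ => /Linf_leP g2; apply: Linf_norm_le => //.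
apply: filterS2 g1 g2 => x /= g1; rewrite -[leLHS]/(-1 * g x) mulN1r => g2.
by rewrite ler_norml lerNl g2.
Qed.

End ContinuousInLinf.

(** * Identifying an abstract completion with [Linf] *)

Section Completion.
Context {K : compactHausdorffType} {R : realType}.
Context {E : banachLatticeType R} {j : cfun K R -> E}.
Hypothesis Ej : dedekind_completion j.

Lemma completion_dense_completion : dense_completion j.
Proof.
have [cE iE mE dE] := Ej; have jle := lattice_isometry_le iE.
split=> [| | | |A [u0 Au0] [b Ab]] //; first by case: iE.
by apply: cE; [exists (j u0), u0|exists b => _ [u Au <-]; exact: Ab].
Qed.

(** Forwards, each [u] with [j u] below the modulus of [x] has a positive part of norm at most [c],
    so [u <= c] pointwise, and such [j u] determine the modulus. Backwards, the lattice norm is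
    monotone and [j] is isometric. *)
Lemma completion_norm (x : E) c : 0 <= c ->
  `|x| <= c <-> x ⊔ - x ⊑ j (cfun_cst c).
Proof.
move=> c0; have [lj jj _ nj] := completion_embedding Ej.
have jc := completion_dense_completion; have jle := dense_completion_le jc.
split=> [xc|h].
  apply: (dense_completion_ext jc) => u ux; apply/jle => k.
  have pu : j (vpos u) ⊑ x ⊔ - x.
    by rewrite /vpos jj (linear_fun0 lj); apply: vjoin_le => //; exact: vmodulus_ge0.
  have : `|vpos u| <= c.
    rewrite -nj; apply: le_trans xc; apply: lattice_norm.
    rewrite vle0_join//; rewrite -[X in X ⊑ _](linear_fun0 lj).
    by apply/jle; exact: vpos_ge0.
  apply: le_trans; apply: le_trans (cfun_norm_ge _ k).
  by apply: le_trans (ler_norm _); rewrite /= le_max lexx.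
have j0 : 0 ⊑ j (cfun_cst c).
  by rewrite -[X in X ⊑ _](linear_fun0 lj); apply/jle => k; rewrite cfun0.
apply: (@le_trans _ _ `|j (cfun_cst c)|).
  by apply: lattice_norm; rewrite [X in _ ⊑ X]vle0_join.
rewrite nj; apply: cfun_norm_le => // k.
by rewrite /= ger0_norm.
Qed.

Lemma Linf_identification_ex : exists T : E -> Linf K R, Linf_identification j T.
Proof.
have [T [lT Tle Tsurj Tj]] :=
  dense_completion_iso completion_dense_completion (@cfun_hat_dense_completion K R).
exists T; split=> //; split=> //.
have TJ := order_iso_join Tle Tsurj.
split=> //; first exact: order_iso_meet.
have T_norm x c : 0 <= c -> `|T x| <= c <-> `|x| <= c.
  move=> c0; rewrite Linf_norm_cst// completion_norm// -Tj -(linear_funN lT) -TJ.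
  exact: Tle.
move=> x; apply/eqP; rewrite eq_le; apply/andP; split.
  by apply/T_norm.
by rewrite -T_norm.
Qed.

End Completion.

(** * Integration against finitely additive measures *)
Section SimpleIntegral.
Context {K : topologicalType} {R : realType}.
Implicit Types (mu : bfa K R) (u s : bmfun K R).

Lemma bfa_preimage_seq mu (T : choiceType) (p : K -> T) (r : seq T) :
  (forall t, baire_property K (p @^-1` [set t])) -> uniq r ->
  baire_property K (p @^-1` [set` r]) /\
  mu (p @^-1` [set` r]) = \sum_(t <- r) mu (p @^-1` [set t]).
Proof.
move=> pb; elim: r => [_|a r IH /= /andP[ar /IH[rb muE]]].
  rewrite set_nil preimage_set0 big_nil bfa_set0; split=> //; exact: baire0.
have -> : [set` a :: r] = [set a] `|` [set` r].
  apply/seteqP; split=> x /=; rewrite inE.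
    by move=> /predU1P[->|xr]; [left|right].
  by move=> [->|xr]; rewrite ?eqxx// xr orbT.
rewrite preimage_setU big_cons -muE; split; first exact: baireU.
apply: bfaU => //; apply/seteqP; split=> // x [/= -> ar'].
by rewrite ar' in ar.
Qed.

Lemma bfa_preimage_finite mu (T : choiceType) (p : K -> T) (D : set T) :
  (forall t, baire_property K (p @^-1` [set t])) -> finite_set D ->
  mu (p @^-1` D) = \sum_(t \in D) mu (p @^-1` [set t]).
Proof.
move=> pb Dfin; rewrite fsbig_finite//=.
rewrite -(bfa_preimage_seq mu pb (fset_uniq _)).2; congr (mu (_ @^-1` _)).
by rewrite fset_setK.
Qed.

Lemma bmfun_fiber u r : baire_property K (u @^-1` [set r]).
Proof. by apply: bmfun_measurable; exact: measurable_set1. Qed.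

(** The integral may be computed over any finite measurable partition, given as the fibres of [p],
    on whose pieces [s] is constant. Pairs of functions serve for linearity, membership in a set for
    indicators. *)
Lemma simple_integral_comp mu (T : choiceType) (p : K -> T) (c : T -> R) s :
  (forall t, baire_property K (p @^-1` [set t])) -> finite_set (range p) ->
  (forall x, s x = c (p x)) ->
  simple_integral mu s = \sum_(t \in range p) c t * mu (p @^-1` [set t]).
Proof.
move=> pb pfin sE.
have rE : range s = c @` range p.
  by rewrite image_comp; apply: eq_imagel => x _; exact: sE.
have sfin : finite_set (range s) by rewrite rE; exact: finite_image.
(* Each fibre of [s] is split into fibres of [p]; after exchanging the sums, only [r = c t]
   contributes for a given [t]. *)
transitivity (\sum_(r \in range s) \sum_(t \in range p)
    if t \in c @^-1` [set r] then r * mu (p @^-1` [set t]) else 0).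
  apply: eq_fsbigr => r _.
  have -> : s @^-1` [set r] = p @^-1` (range p `&` c @^-1` [set r]).
    apply/seteqP; split=> x /=; rewrite sE; last by case.
    by move=> <-; split=> //; exists x.
  rewrite bfa_preimage_finite//; last exact: finite_setIl.
  rewrite mulr_fsumr fsbig_mkcondr; apply: eq_fsbigr => t _.
  by case: ifP.
rewrite exchange_fsbig//; apply: eq_fsbigr => t /set_mem pt.
rewrite (fsbigD1 (c t))//; last by rewrite rE; exists t.
rewrite /= ifT; last exact/mem_set.
rewrite fsbig1 ?addr0// => r [_ /= rc]; rewrite ifF//.
by apply/negP => /set_mem /= e; apply: rc.
Qed.

(** The fibres of [x |-> (s x, t x)] refine those of [s], of [t] and of the combination. *)
Lemma simple_integral_linear mu a s (t : bmfun K R) :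
  finite_set (range s) -> finite_set (range t) ->
  simple_integral mu (a *: s + t) = a * simple_integral mu s + simple_integral mu t.
Proof.
move=> sfin tfin; pose p x := (s x, t x).
have pb z : baire_property K (p @^-1` [set z]).
  have -> : p @^-1` [set z] = s @^-1` [set z.1] `&` t @^-1` [set z.2].
    apply/seteqP; split=> x /=; first by move=> <-.
    by rewrite /p => -[-> ->]; case: z.
  by apply: baireI; exact: bmfun_fiber.
have pfin : finite_set (range p).
  apply: sub_finite_set (finite_setX sfin tfin) => _ [x _ <-].
  by split; exists x.
rewrite (@simple_integral_comp mu _ p (fun z => a * z.1 + z.2))//.
rewrite (@simple_integral_comp mu _ p fst s)// (@simple_integral_comp mu _ p snd t)//.
rewrite mulr_fsumr -fsbig_split//=; apply: eq_fsbigr => z _.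
by rewrite mulrDl mulrA.
Qed.

(* Fibres over values larger than [c] are meagre, hence do not contribute. *)
Lemma simple_integral_norm mu s c : 0 <= c -> finite_set (range s) ->
  comeagre [set x | `|s x| <= c] -> `|simple_integral mu s| <= c * bfa_norm mu.
Proof.
move=> c0 sfin sc; rewrite /simple_integral fsbig_finite//=.
apply: (le_trans (ler_norm_sum _ _ _)).
set rs := fset_set (range s).
apply: (@le_trans _ _ (\sum_(r <- rs) c * `|mu (s @^-1` [set r])|)).
  apply: ler_sum => r _; rewrite normrM.
  have [rc|cr] := leP `|r| c; first by rewrite ler_wpM2r.
  rewrite [mu _]bfa_meagre ?normr0 ?mulr0//; apply: meagre_sub sc => x /= ->.
  by apply/negP; rewrite -ltNge.
rewrite -mulr_sumr ler_wpM2l// (big_nth 0) big_mkord.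
apply: (@bfa_norm_ub _ _ mu _ (fun i => s @^-1` [set rs`_i])).
  by move=> i; exact: bmfun_fiber.
move=> i k _ _ [x [/= -> /eqP]]; rewrite nth_uniq//; last exact: fset_uniq.
by move=> /eqP/val_inj.
Qed.

Lemma simple_approx_ex u e : 0 < e -> simple_approx u e !=set0.
Proof.
move=> e0; have [M uM] := bmfun_bounded u.
(* Rounding down to the grid of step [e] starting at [- M]. The shift by [M] makes the argument of
   [truncn] nonnegative on values of [u]; monotonicity of [h] gives measurability. *)
pose h r : R := (Num.truncn ((r + M) / e))%:R * e - M.
have hm : measurable_fun setT h.
  apply: measurable_realfun.nondecreasing_measurable => // x y xy.
  rewrite lerB// ler_wpM2r ?ler_nat ?le_truncn ?ler_pM2r ?invr_gt0 ?lerD2r//.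
  exact: ltW.
have uM0 x : 0 <= (u x + M) / e.
  rewrite divr_ge0 ?(ltW e0)// -lerBlDr sub0r lerNl.
  by rewrite (le_trans (ler_norm _))// normrN.
have h_near x : `|u x - h (u x)| <= e.
  have /andP[] := truncn_itv (uM0 x); rewrite /h; set q := Num.truncn _.
  rewrite ler_pdivlMr// ltr_pdivrMr// -natr1 mulrDl mul1r => h1 h2.
  rewrite opprB addrA ger0_norm ?subr_ge0// lerBlDl; exact: ltW.
have hP : h \o u \in @bmfun_pred R K.
  apply/mem_set; split; first exact: baire_measurable_comp hm (@bmfun_measurable _ _ u).
  exists (M + e) => x /=.
  rewrite -[h _](subKr (u x)) (le_trans (ler_normB _ _))// lerD//.
exists (BMFun hP); split=> //.
pose N := Num.truncn ((M + M) / e).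
apply: (@sub_finite_set _ _ ((fun n => n%:R * e - M) @` `I_N.+1)).
  move=> _ [x _ <-] /=; exists (Num.truncn ((u x + M) / e)) => //=.
  rewrite ltnS le_truncn// ler_pM2r ?invr_gt0// lerD2r.
  exact: le_trans (ler_norm _) (uM x).
exact/finite_image/finite_II.
Qed.

Lemma simple_approxB mu u s (t : bmfun K R) e d : simple_approx u e s -> simple_approx u d t ->
  0 < e -> 0 < d ->
  `|simple_integral mu s - simple_integral mu t| <= (e + d) * bfa_norm mu.
Proof.
move=> [sfin us] [tfin ut] e0 d0.
have := simple_integral_linear mu (-1) tfin sfin; rewrite mulN1r [X in _ = X]addrC => <-.
apply: simple_integral_norm; first by rewrite addr_ge0 ?ltW.
  apply: sub_finite_set (finite_image (fun z : R * R => -1 * z.1 + z.2) (finite_setX tfin sfin)).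
  by move=> _ [x _ <-]; exists (t x, s x) => //; split; exists x.
apply: filterE => x /=; rewrite -[X in `|X|]/(-1 * t x + s x) mulN1r.
have -> : - t x + s x = (u x - t x) - (u x - s x).
  by ring.
by rewrite (le_trans (ler_normB _ _))// addrC lerD.
Qed.

End SimpleIntegral.

Lemma le0_of_small (R : realFieldType) (x C : R) : 0 <= C ->
  (forall e, 0 < e -> x <= e * C) -> x <= 0.
Proof.
move=> C0 h; apply/ler_addgt0Pl => e e0; rewrite addr0.
(* Dividing by [C + 1] instead of [C] covers [C = 0]. *)
have C1 : 0 < C + 1 by rewrite ltr_wpDl.
apply: (le_trans (h (e / (C + 1)) _)); first by rewrite divr_gt0.
by rewrite mulrAC ler_pdivrMr// ler_pM2l// lerDl.
Qed.

(** * The integral of bounded measurable functions *)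

Section BfaIntegral.
Context {K : topologicalType} {R : realType}.
Implicit Types (mu : bfa K R) (u v s t : bmfun K R).

(** Each approximant gives an interval of radius [e * bfa_norm mu] around its integral. By
    [simple_approxB] any two of these meet, so the supremum of the left endpoints, collected in
    [lo], lies in all of them; it is the limit. *)
Lemma bfa_integral_approx mu u s e : 0 < e -> simple_approx u e s ->
  `|bfa_integral mu u - simple_integral mu s| <= e * bfa_norm mu.
Proof.
pose D := [set p : R * bmfun K R | 0 < p.1 /\ simple_approx u p.1 p.2].
pose lo := [set simple_integral mu p.2 - p.1 * bfa_norm mu | p in D].
have lo_le e' s' : 0 < e' -> simple_approx u e' s' ->
    ubound lo (simple_integral mu s' + e' * bfa_norm mu).
  move=> e'0 us' _ [[d t] /= [d0 ut] <-]; rewrite lerBlDr -addrA -mulrDl -lerBlDl.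
  by apply: le_trans (ler_norm _) _; rewrite [e' + d]addrC; exact: simple_approxB ut us' d0 e'0.
have lo0 : lo !=set0.
  have [s' us'] := simple_approx_ex u (@ltr01 R).
  by exists (simple_integral mu s' - 1 * bfa_norm mu), (1, s').
have L_near e' s' : 0 < e' -> simple_approx u e' s' ->
    `|sup lo - simple_integral mu s'| <= e' * bfa_norm mu.
  move=> e'0 us'; rewrite ler_distl; apply/andP; split.
    apply: ub_le_sup; last by exists (e', s').
    by exists (simple_integral mu s' + e' * bfa_norm mu); exact: lo_le.
  by apply: ge_sup => //; exact: lo_le.
suff -> : bfa_integral mu u = sup lo by exact: L_near.
pose F := filter_from [set e : R | 0 < e] (simple_approx u).
have FF : ProperFilter F.
  apply: filter_from_proper; last by move=> d; exact: simple_approx_ex.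
  apply: filter_from_filter; first by exists 1 => /=.
  move=> d d' /= d0 d'0; exists (Num.min d d'); first by rewrite /= lt_min d0.
  move=> t [tfin ut]; split; split=> // x; apply: le_trans (ut x) _.
    by rewrite ge_min lexx.
  by rewrite ge_min lexx orbT.
apply/cvg_lim => //; apply/cvgrPdist_le => /= eps eps0.
have m0 : 0 < bfa_norm mu + 1 by rewrite ltr_wpDl ?bfa_norm_ge0.
exists (eps / (bfa_norm mu + 1)); first by rewrite /= divr_gt0.
move=> t ut /=; apply: (le_trans (L_near _ _ _ ut)); first by rewrite divr_gt0.
by rewrite mulrAC ler_pdivrMr// ler_pM2l// lerDl.
Qed.

Lemma bfa_integral_simple mu s : finite_set (range s) ->
  bfa_integral mu s = simple_integral mu s.
Proof.
move=> sfin; apply/eqP; rewrite -subr_eq0 -normr_le0.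
apply: (le0_of_small (bfa_norm_ge0 mu)) => e e0; apply: bfa_integral_approx => //.
by split=> // x; rewrite subrr normr0 ltW.
Qed.

Lemma bfa_integral_linear mu a u v :
  bfa_integral mu (a *: u + v) = a * bfa_integral mu u + bfa_integral mu v.
Proof.
apply/eqP; rewrite -subr_eq0 -normr_le0.
(* One summand [|a| + 1] is the error of approximating [a *: u + v], the other that of combining the
   approximations of [u] and [v]. *)
have C0 : 0 <= bfa_norm mu * ((`|a| + 1) + (`|a| + 1)).
  by rewrite mulr_ge0 ?bfa_norm_ge0 ?addr_ge0.
apply: (le0_of_small C0) => e e0.
have [s us] := simple_approx_ex u e0; have [t vt] := simple_approx_ex v e0.
have [[sfin us'] [tfin vt']] := (us, vt).
have w : simple_approx (a *: u + v) ((`|a| + 1) * e) (a *: s + t).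
  split.
    apply: sub_finite_set (finite_image (fun z : R * R => a * z.1 + z.2) (finite_setX sfin tfin)).
    by move=> _ [x _ <-]; exists (s x, t x) => //; split; exists x.
  move=> x; have -> : (a *: u + v : bmfun K R) x - (a *: s + t : bmfun K R) x =
      a * (u x - s x) + (v x - t x).
    by rewrite !bmfunD !bmfunZ opprD addrACA mulrBr.
  rewrite (le_trans (ler_normD _ _))// mulrDl mul1r normrM lerD//.
  by rewrite ler_wpM2l.
have ae0 : 0 < (`|a| + 1) * e by rewrite mulr_gt0// ltr_wpDl.
have h1 := bfa_integral_approx mu ae0 w.
have h2 := bfa_integral_approx mu e0 us.
have h3 := bfa_integral_approx mu e0 vt.
move: h1; rewrite simple_integral_linear//.
set Iw := bfa_integral mu (_ + _); move=> h1.
have -> : Iw - (a * bfa_integral mu u + bfa_integral mu v) =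
    (Iw - (a * simple_integral mu s + simple_integral mu t)) -
    (a * (bfa_integral mu u - simple_integral mu s) +
     (bfa_integral mu v - simple_integral mu t)) by ring.
apply: (le_trans (ler_normB _ _)).
have h4 : `|a * (bfa_integral mu u - simple_integral mu s) +
     (bfa_integral mu v - simple_integral mu t)| <= (`|a| + 1) * e * bfa_norm mu.
  rewrite (le_trans (ler_normD _ _))// mulrDl mul1r mulrDl normrM lerD//.
  by rewrite -mulrA ler_wpM2l.
apply: (le_trans (lerD h1 h4)); rewrite le_eqVlt; apply/orP; left; apply/eqP.
by ring.
Qed.

Lemma bfa_integral_norm mu u c : 0 <= c -> comeagre [set x | `|u x| <= c] ->
  `|bfa_integral mu u| <= c * bfa_norm mu.
Proof.
move=> c0 uc; rewrite -subr_le0.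
have C0 := bfa_norm_ge0 mu.
(* One [bfa_norm mu] pays for replacing [u] by [s], the other for the weaker bound [c + e] on
   [s]. *)
apply: (le0_of_small (addr_ge0 C0 C0)) => e e0.
have [s us] := simple_approx_ex u e0; have [sfin us'] := us.
have h1 := bfa_integral_approx mu e0 us.
have h2 : `|simple_integral mu s| <= (c + e) * bfa_norm mu.
  apply: simple_integral_norm => //; first by rewrite addr_ge0// ltW.
  apply: filterS uc => x /= ux; rewrite -[s x](subKr (u x)).
  by rewrite (le_trans (ler_normB _ _))// lerD.
rewrite lerBlDr -[bfa_integral mu u](subrK (simple_integral mu s)).
apply: (le_trans (ler_normD _ _)); apply: (le_trans (lerD h1 h2)).
by rewrite mulrDl mulrDr -addrA [c * _ + _]addrC.
Qed.

Lemma bm_indic_pred (A : set K) (bA : baire_property K A) :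
  (\1_A : K -> R) \in @bmfun_pred R K.
Proof.
apply/mem_set; split; last first.
  by exists 1 => x; rewrite indicE; case: (x \in A); rewrite ?normr1 ?normr0.
apply: baire_measurableP => c.
have [c0|c0] := ltP c 0.
  rewrite (_ : [set _ | _] = setT); first exact: baireT.
  by apply/seteqP; split=> x //= _; rewrite indicE (lt_le_trans c0).
have [c1|c1] := ltP c 1.
  rewrite (_ : [set _ | _] = A)//; apply/seteqP; split=> x /=; rewrite indicE.
    by case: (boolP (x \in A)) => [/set_mem//|_]; rewrite ltNge c0.
  by move=> /mem_set ->.
rewrite (_ : [set _ | _] = set0); first exact: baire0.
apply/seteqP; split=> x //=; rewrite indicE ltNge => /negP; apply.
by apply: le_trans c1; case: (x \in A).
Qed.

Definition bm_indic (A : set K) (bA : baire_property K A) : bmfun K R :=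
  BMFun (bm_indic_pred bA).

Lemma bm_indicE (A : set K) (bA : baire_property K A) x :
  bm_indic bA x = (x \in A)%:R.
Proof. by rewrite /= indicE. Qed.

Lemma bmfun_sumE (I : Type) (r : seq I) (P : pred I) (F : I -> bmfun K R) x :
  (\sum_(i <- r | P i) F i : bmfun K R) x = \sum_(i <- r | P i) F i x.
Proof. by apply: (big_morph (fun f : bmfun K R => f x)) => //. Qed.

Lemma simple_sum_indic s : finite_set (range s) ->
  s = \sum_(r <- fset_set (range s)) r *: bm_indic (bmfun_fiber s r).
Proof.
move=> sfin; apply/val_inj/funext => x; rewrite -[RHS]/(bmfun_fun _ x) bmfun_sumE.
under eq_bigr do rewrite bmfunZ bm_indicE.
rewrite (bigD1_seq (s x))/= ?fset_uniq//; last first.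
  by rewrite in_fset_set//; apply/mem_set; exists x.
rewrite mem_set// mulr1 big1 ?addr0// => r rs.
rewrite memNset ?mulr0// => /= e.
by rewrite e eqxx in rs.
Qed.

Lemma bm_indic_range (A : set K) (bA : baire_property K A) :
  finite_set (range (bm_indic bA)).
Proof.
apply: (@sub_finite_set _ _ [set 0; 1]); last by rewrite finite_setU; split; exact: finite_set1.
move=> _ [x _ <-]; rewrite bm_indicE; case: (x \in A); by [right|left].
Qed.

Lemma bfa_integral_indic mu (A : set K) (bA : baire_property K A) :
  bfa_integral mu (bm_indic bA) = mu A.
Proof.
rewrite bfa_integral_simple; last exact: bm_indic_range.
rewrite (@simple_integral_comp _ _ mu _ (fun x => x \in A) (fun b => b%:R)).
(* The range may miss a boolean; summing over both adds only the measure of an empty fibre. *)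
- rewrite (fsbig_widen _ setT)//=.
    rewrite (fsbigE [:: true; false])//=; last by case.
    rewrite !big_cons big_nil ?in_setT /= mul0r mul1r ?addr0.
    congr (mu _); apply/seteqP; split=> x /=; first by move/set_mem.
    exact: mem_set.
  move=> b [_ nb] /=; rewrite (_ : _ @^-1` _ = set0) ?bfa_set0 ?mulr0//.
  by apply/seteqP; split=> // x /= xb; apply: nb; exists x.
- have bP : [set x | x \in A] = A by apply/seteqP; split=> x /=; [move/set_mem|exact: mem_set].
  case; first by rewrite (_ : _ @^-1` _ = A).
  rewrite (_ : _ @^-1` _ = ~` A); first exact: baireC.
  apply/seteqP; split=> x /=; first by move/negbT; rewrite notin_setE.
  by move=> nA; rewrite memNset.
- by apply: (@sub_finite_set _ _ setT) => //; exact: finite_finset.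
- by move=> x; rewrite bm_indicE.
Qed.

End BfaIntegral.

(** * Duality *)
Section Representation.
Context {K : topologicalType} {R : realType} {L : bmfun K R -> R} {C : R}.
Hypothesis L_scalar : scalar L.
Hypothesis L_norm : forall (u : bmfun K R) (c : R), 0 <= c -> comeagre [set x | `|u x| <= c] ->
  `|L u| <= c * C.

Let L0 : L 0 = 0. Proof. exact: (linear_fun0 (V := R^o) L_scalar). Qed.
Let LD (u v : bmfun K R) : L (u + v) = L u + L v.
Proof. exact: (linear_funD (V := R^o) L_scalar). Qed.
Let LZ a (u : bmfun K R) : L (a *: u) = a * L u.
Proof. exact: (linear_funZ (V := R^o) L_scalar). Qed.
Let LB (u v : bmfun K R) : L (u - v) = L u - L v.
Proof. exact: (linear_funB (V := R^o) L_scalar). Qed.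
Let L_sum n (F : 'I_n -> bmfun K R) : L (\sum_(i < n) F i) = \sum_(i < n) L (F i).
Proof. exact: (big_morph L LD L0). Qed.

(** [bm_indic] takes a proof that [A] has the Baire property, hence the case distinction; the value
    0 elsewhere is the convention of [bfa]. *)
Definition representing_fun (A : set K) : R :=
  match pselect (baire_property K A) with
  | left bA => L (bm_indic bA)
  | right _ => 0
  end.

Lemma representing_funE (A : set K) (bA : baire_property K A) :
  representing_fun A = L (bm_indic bA).
Proof.
rewrite /representing_fun; case: pselect => // bA'; congr L.
exact/val_inj.
Qed.

Lemma representing_fun_bfa : representing_fun \in @bfa_pred K R.
Proof.
apply/mem_set; split=> [A nA|A B bA bB AB||N mN].
- by rewrite /representing_fun; case: pselect.
- rewrite (representing_funE bA) (representing_funE bB) (representing_funE (baireU bA bB)).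
  rewrite -LD; congr L; apply/val_inj/funext => x.
  rewrite -[LHS]/(bm_indic _ x) -[RHS]/(bm_indic _ x + bm_indic _ x) !bm_indicE in_setU.
  have [/set_mem xA|_] := boolP (x \in A); have [/set_mem xB|_] := boolP (x \in B);
    rewrite /= ?addr0 ?add0r//.
  by have : (A `&` B) x by []; rewrite AB.
- exists `|C| => A; rewrite /representing_fun; case: pselect => [bA|_]; last by rewrite normr0.
  apply: le_trans (ler_norm _); rewrite -[leRHS]mul1r; apply: L_norm => //.
  apply: filterE => x; rewrite /mkset bm_indicE.
  by case: (x \in A); rewrite ?normr1 ?normr0.
- rewrite (representing_funE (baire_meagre mN)); apply/eqP; rewrite -normr_le0.
  (* The case [c = 0] of the bound: the indicator of [N] vanishes off a meagre set. *)
  rewrite -(mul0r C); apply: L_norm => //; rewrite /comeagre /=.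
  apply: meagre_sub mN => x /= h; apply: contrapT => Nx; apply: h.
  by rewrite indicE memNset// normr0.
Qed.

Definition representing : bfa K R := Bfa representing_fun_bfa.

Lemma representing_integral u : L u = bfa_integral representing u.
Proof.
have L_simple (s : bmfun K R) : finite_set (range s) -> L s = simple_integral representing s.
  move=> sfin; rewrite {1}(simple_sum_indic sfin) (big_morph L LD L0).
  rewrite /simple_integral fsbig_finite//; apply: eq_bigr => r _.
  by rewrite LZ -(representing_funE (bmfun_fiber s r)).
apply/eqP; rewrite -subr_eq0 -normr_le0.
have C0 : 0 <= `|C| + bfa_norm representing by rewrite addr_ge0 ?bfa_norm_ge0.
apply: (le0_of_small C0) => e e0; have [s us] := simple_approx_ex u e0.
have [sfin us'] := us; have := bfa_integral_approx representing e0 us.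
rewrite -L_simple// => h; have h' : `|L (u - s)| <= e * C.
  by apply: L_norm; [exact: ltW|apply: filterE].
rewrite -(subrK (L s) (L u)) -LB -addrA -[L s - _]opprB (le_trans (ler_normB _ _))//.
by rewrite mulrDr lerD// (le_trans h')// ler_wpM2l// ?ler_norm// ltW.
Qed.

(* Test [L] against the signed indicator of a finite partition. *)
Lemma representing_norm : bfa_norm representing <= C.
Proof.
apply: bfa_norm_le => n F bF tF.
pose w : bmfun K R := \sum_(i < n) Num.sg (representing (F i)) *: bm_indic (bF i).
have -> : \sum_(i < n) `|representing (F i)| = L w.
  rewrite L_sum; apply: eq_bigr => i _.
  by rewrite LZ -(representing_funE (bF i)) normrEsg.
apply: (le_trans (ler_norm _)); rewrite -[leRHS]mul1r; apply: L_norm => //.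
apply: filterE => x; rewrite /mkset bmfun_sumE.
under eq_bigr do rewrite bmfunZ bm_indicE.
have [[i Fix]|nF] := pselect (exists i, F i x); last first.
  rewrite big1 ?normr0// => i _; rewrite memNset ?mulr0// => Fix.
  by apply: nF; exists i.
rewrite (bigD1 i)//= big1 ?addr0 => [|k ki].
  by rewrite mem_set// mulr1 normr_sg; case: (_ != 0).
rewrite memNset ?mulr0// => Fkx; move/eqP: ki; apply.
by apply: tF => //; exists x.
Qed.

End Representation.

Lemma bfa_integral_representation (K : topologicalType) (R : realType)
    (L : bmfun K R -> R) (C : R) : scalar L ->
  (forall (u : bmfun K R) (c : R), 0 <= c -> comeagre [set x | `|u x| <= c] -> `|L u| <= c * C) ->
  exists mu : bfa K R, (forall u, L u = bfa_integral mu u) /\ bfa_norm mu <= C.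
Proof.
move=> lL nL; exists (representing lL nL); split.
  exact: representing_integral.
exact: representing_norm.
Qed.

(** * Extensionality of measures and positivity of the integral *)

Section IntegralProperties.
Context {K : topologicalType} {R : realType}.
Implicit Types (mu nu : bfa K R) (u v : bmfun K R).

Lemma bfa_ext mu nu :
  (forall (A : set K) (bA : baire_property K A), mu A = nu A) -> mu = nu.
Proof.
move=> h; apply/val_inj/funext => A.
have [bA|nA] := pselect (baire_property K A); first exact: h.
by rewrite /= !bfa_out.
Qed.

(** Absolute values drop, and the complement of the union of the pieces has nonnegative mass. *)
Lemma bfa_norm_pos mu : 0 ⊑ mu -> bfa_norm mu <= mu setT.
Proof.
move=> mu0; apply: bfa_norm_le => n F bF tF.
rewrite (eq_bigr (fun i => mu (F i))); last first.
  by move=> i _; rewrite ger0_norm//; exact: mu0.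
have [bU <-] := bfa_bigsetU mu xpredT bF tF.
set U := \big[_/_]_(_ < _) _.
rewrite -(setUv U) bfaU ?setICr//; last exact: baireC.
by rewrite lerDl; apply: mu0; exact: baireC.
Qed.

(** Positivity follows from the norm bound: with [m = |M|], generically [0 <= m - u <= m], so
    [m * mu setT] minus the integral of [u] is at most [m * bfa_norm mu], hence at most
    [m * mu setT]. *)
Lemma bfa_integral_ge0 mu u : 0 ⊑ mu -> comeagre [set x | 0 <= u x] ->
  0 <= bfa_integral mu u.
Proof.
move=> mu0 u0; have [M uM] := bmfun_bounded u.
have := bfa_integral_linear mu (-1) u (`|M| *: bm_indic baireT).
have -> : bfa_integral mu (`|M| *: bm_indic baireT) = `|M| * mu setT.
  have := bfa_integral_linear mu `|M| (bm_indic baireT) 0.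
  have -> : bfa_integral mu 0 = 0.
    apply/eqP; rewrite -normr_le0 -(mul0r (bfa_norm mu)).
    by apply: bfa_integral_norm => //; apply: filterE => x /=; rewrite normr0.
  by rewrite !addr0 bfa_integral_indic.
set w := (-1 *: u + _); rewrite mulN1r [X in _ = X]addrC => wE.
have := @bfa_integral_norm _ _ mu w `|M| (normr_ge0 _).
rewrite wE => h; rewrite -oppr_le0 -(lerD2l (`|M| * mu setT)) addr0.
apply: le_trans (ler_norm _) _; apply: le_trans (h _) _; last first.
  by rewrite ler_wpM2l// bfa_norm_pos.
apply: filterS u0 => x /= u0.
rewrite -[X in `|X|]/(-1 * u x + `|M| * bm_indic baireT x) bm_indicE mem_set// mulr1 mulN1r addrC.
have uM' : u x <= `|M| by rewrite (le_trans (ler_norm _))// (le_trans (uM x))// ler_norm.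
by rewrite ger0_norm ?subr_ge0// lerBlDr lerDl.
Qed.

End IntegralProperties.

(** * The dual of a space identified with [Linf] *)

Section Duality.
Context {K : compactHausdorffType} {R : realType}.
Context {E : banachLatticeType R} {T : E -> Linf K R}.
Hypothesis T_iso : isometric_lattice_isomorphism T.

Let T_lin : linear T. Proof. by case: T_iso => -[]. Qed.
Let T_norm x : `|T x| = `|x|. Proof. by case: T_iso => -[]. Qed.
Let T_le x y : T x ⊑ T y <-> x ⊑ y.
Proof. by apply: lattice_isometry_le; case: T_iso. Qed.

Let T_inj : injective T. Proof. exact: (order_iso_inj T_le). Qed.

Lemma dual_norm_bound (phi : dual E) x : `|phi x| <= `|x| * dual_norm phi.
Proof.
have [->|x0] := eqVneq x 0; first by rewrite dual0 !normr0 mul0r.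
have nx : 0 < `|x| by rewrite normr_gt0.
rewrite mulrC -ler_pdivrMr// -[X in _ / X]ger0_norm// -normrV ?unitfE ?gt_eqF//.
rewrite -normrM mulrC -dualZ; apply: dual_norm_le.
by rewrite normrZ normfV normr_id mulVf// gt_eqF.
Qed.

(** [phi] is moved to bounded functions along a right inverse of [T], which respects linear
    combinations because [T] is linear and injective. *)
Lemma dual_representation (phi : dual E) : exists mu : bfa K R,
  (forall x u, T x = hat u -> phi x = bfa_integral mu u) /\
  bfa_norm mu <= dual_norm phi.
Proof.
have /choice[Ti TiK] q : exists x, T x = q by case: T_iso.
have [a u v|u c c0 uc|mu [muE mun]] :=
  @bfa_integral_representation K R (fun u => phi (Ti (hat u))) (dual_norm phi).
- rewrite -[RHS]/(a * phi _ + phi _) -dual_scalar; congr (phi _); apply: T_inj.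
  by rewrite T_lin !TiK hatD hatZ.
- apply: (le_trans (dual_norm_bound _ _)); rewrite ler_wpM2r ?dual_norm_ge0//.
  by rewrite -T_norm TiK; exact: Linf_norm_le.
- exists mu; split=> // x u xu; rewrite -muE; congr (phi _); apply: T_inj.
  by rewrite TiK.
Qed.

Lemma representation_unique (phi : dual E) (mu nu : bfa K R) :
  (forall x u, T x = hat u -> phi x = bfa_integral mu u) ->
  (forall x u, T x = hat u -> phi x = bfa_integral nu u) -> mu = nu.
Proof.
move=> hmu hnu; apply: bfa_ext => A bA.
have [x xA] : exists x, T x = hat (bm_indic bA) by case: T_iso.
by rewrite -(bfa_integral_indic mu bA) -(bfa_integral_indic nu bA) -(hmu x)// -(hnu x).
Qed.

(** The integral vanishes on functions that are zero off a meagre set, so it depends only on the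
    class and any representative of [T x] may be integrated. *)
Lemma dual_of_bfa (mu : bfa K R) : exists phi : dual E,
  forall x u, T x = hat u -> phi x = bfa_integral mu u.
Proof.
have repr_eq u v : hat u = hat v -> bfa_integral mu u = bfa_integral mu v.
  move=> /hatP uv; apply/eqP; rewrite -subr_eq0 -normr_le0.
  have := bfa_integral_linear mu (-1) v u; rewrite mulN1r [X in _ = X]addrC => <-.
  rewrite -(mul0r (bfa_norm mu)); apply: bfa_integral_norm => //.
  apply: filterS uv => x /= uv.
  by rewrite -[X in `|X|]/(-1 * v x + u x) uv mulN1r addNr normr0.
pose f x := bfa_integral mu (repr (T x)).
have fE x u : T x = hat u -> f x = bfa_integral mu u.
  by move=> xu; apply: repr_eq; rewrite hat_repr.
have fP : f \in @dual_pred R E.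
  apply/dual_predP; split=> [a x y|].
    rewrite (fE _ (a *: repr (T x) + repr (T y))) ?bfa_integral_linear//.
    by rewrite hatD hatZ !hat_repr T_lin.
  exists (bfa_norm mu) => [|x]; first exact: bfa_norm_ge0.
  rewrite mulrC -T_norm; apply: bfa_integral_norm; first exact: normr_ge0.
  by rewrite -[X in `|X|]hat_repr; exact: Linf_normP.
by exists (Dual fP).
Qed.

Variable S : dual E -> bfa K R.
Hypothesis SP : forall (phi : dual E) x u, T x = hat u ->
  phi x = bfa_integral (S phi) u.

Lemma representation_indic phi x (A : set K) (bA : baire_property K A) :
  T x = hat (bm_indic bA) -> S phi A = phi x.
Proof. by move=> xA; rewrite (SP phi xA) bfa_integral_indic. Qed.

Lemma representation_linear : linear S.
Proof.
move=> a phi psi; apply: bfa_ext => A bA.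
have [x xA] : exists x, T x = hat (bm_indic bA) by case: T_iso.
by rewrite bfaDE bfaZE !(representation_indic _ xA).
Qed.

Lemma representation_surj mu : exists phi, S phi = mu.
Proof.
have [phi phiP] := dual_of_bfa mu; exists phi.
by apply: (representation_unique (phi := phi)) => //; exact: SP.
Qed.

(** From measures to functionals, the integral against [S (psi - phi)] is positive; conversely,
    functionals are tested on indicators. *)
Lemma representation_le phi psi : S phi ⊑ S psi <-> phi ⊑ psi.
Proof.
split=> [/vle_subr Sle x x0|le A bA].
  have -> : phi x = psi x - (psi - phi) x.
    by rewrite -[(psi - phi) x]/(psi x - phi x) subKr.
  rewrite lerBlDr lerDl.
  have Tx : T x = hat (repr (T x)) by rewrite hat_repr.
  rewrite (SP (psi - phi) Tx); apply: bfa_integral_ge0.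
    by rewrite (linear_funB representation_linear).
  have : 0 ⊑ T x by rewrite -[X in X ⊑ _](linear_fun0 T_lin); apply/T_le.
  by rewrite Tx -hat0 hat_repr => h; apply: (Linf_leP 0 _).1; rewrite hat_repr.
have [x xA] : exists x, T x = hat (bm_indic bA) by case: T_iso.
rewrite !(representation_indic _ xA); apply: le; apply/T_le.
rewrite (linear_fun0 T_lin) xA -hat0; apply/Linf_leP; apply: filterE => y.
by rewrite /mkset bm_indicE.
Qed.

(** By uniqueness [S phi] is the measure of [dual_representation], which carries one bound; the
    other is the integral estimate on the unit ball. *)
Lemma representation_norm phi : `|S phi| = `|phi|.
Proof.
rewrite -[LHS]/(bfa_norm (S phi)) -[RHS]/(dual_norm phi).
apply/eqP; rewrite eq_le; apply/andP; split.
  have [mu [muP]] := dual_representation phi.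
  by rewrite (representation_unique muP (@SP phi)).
apply: dual_norm_ge => x x1.
have Tx : T x = hat (repr (T x)) by rewrite hat_repr.
rewrite (SP phi Tx) -[leRHS]mul1r; apply: bfa_integral_norm => //.
have := Linf_normP (repr (T x)); apply: filterS => y /= h; apply: le_trans h _.
by rewrite hat_repr -[Linf_norm _]/(`|T x|) T_norm.
Qed.

Lemma representation_isomorphism : isometric_lattice_isomorphism S.
Proof.
have SJ := order_iso_join representation_le representation_surj.
split; last exact: representation_surj.
split; [exact: representation_linear|exact: SJ| |exact: representation_norm].
exact: (order_iso_meet representation_le representation_surj representation_linear).
Qed.

End Duality.

Theorem theorem4p2 (R : realType) (K : compactHausdorffType)
    (E : banachLatticeType R) (j : cfun K R -> E)
    (Ej : dedekind_completion j) :
  [/\ exists S : dual E -> bfa K R, isometric_lattice_isomorphism S,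
      exists T : E -> Linf K R, Linf_identification j T &
      forall T : E -> Linf K R, Linf_identification j T ->
        (forall phi : dual E, exists! mu : bfa K R,
           forall (x : E) (u : bmfun K R), T x = hat u ->
             phi x = bfa_integral mu u) /\
        (forall S : dual E -> bfa K R,
           (forall (phi : dual E) (x : E) (u : bmfun K R), T x = hat u ->
             phi x = bfa_integral (S phi) u) ->
           isometric_lattice_isomorphism S)].
Proof.
have [T0 T0P] := Linf_identification_ex Ej.
have repr_ex T : Linf_identification j T -> forall phi : dual E, exists! mu : bfa K R,
    forall (x : E) (u : bmfun K R), T x = hat u -> phi x = bfa_integral mu u.
  move=> [T_iso _] phi; have [mu [muP _]] := dual_representation T_iso phi.
  by exists mu; split=> // nu nuP; exact: (representation_unique T_iso muP nuP).
split; [|by exists T0|move=> T TP; split; first exact: repr_ex].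
  have /choice[S SP] (phi : dual E) : exists mu : bfa K R,
      forall (x : E) (u : bmfun K R), T0 x = hat u -> phi x = bfa_integral mu u.
    by have [mu [muP _]] := repr_ex T0 T0P phi; exists mu.
  by exists S; apply: (representation_isomorphism T0P.1) => phi; exact: SP.
by move=> S SP; apply: (representation_isomorphism TP.1) => phi; exact: SP.
Qed.
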